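(* Let $X \subset S^6$ be such that $A(X) \subseteq \{\pm\frac{1}{5}, \pm\frac{3}{5}\}$. Then $|X| \le 72$, and $|X| = 72$ only if $X \simeq X_7$.
   Context: $S^{n-1}$ is the unit sphere of $\mathbb{R}^n$ and $(\cdot,\cdot)$ the standard inner product. For $X \subseteq \mathbb{R}^n$, $A(X) := \{(x,x') \mid x,x' \in X,\ x \neq x'\}$. The norm of $x$ is $N(x) := (x,x)$, and for a lattice $L$, $S(L) := \{x \in L \mid N(x) = 2\}$ is the set of its roots. Let $e_1,\dots,e_8$ be the standard basis of $\mathbb{R}^8$, $\mathbf{1}$ the all-one vector of $\mathbb{R}^8$, $D_8$ the lattice generated over $\mathbb{Z}$ by the vectors $e_i \pm e_j$ ($1 \le i,j \le 8$), $E_8$ the lattice generated over $\mathbb{Z}$ by $D_8$ and $\frac{1}{2}\mathbf{1}$, $E_7 := E_8 \cap x^\perp$ for a root $x$ of $E_8$, and $E_6 := E_7 \cap y^\perp$ for a root $y$ of $E_7$ (up to isometry, the choices of $x,y$ do not matter). The lattice $E_6$ has rank $6$, and its linear span is identified isometrically with $\mathbb{R}^6$. Define $$X_7 := \Bigl\{ \bigl[\sqrt{\tfrac{2}{5}}\, x, \sqrt{\tfrac{1}{5}}\bigr] \;\Big|\; x \in S(E_6) \Bigr\} \subset S^6,$$ where $[\cdot,\cdot]$ denotes concatenation of coordinates; $|X_7| = 72$. For $X, X' \subseteq S^{d-1}$, $X \simeq X'$ (equivalence) means that $X'$ can be obtained from $X$ by applying an orthogonal transformation of $\mathbb{R}^d$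 and replacing some of the vectors by their opposites.
   Formalization: E_6 is taken as E_7 ∩ y^⊥ with y a root of E_8 such that (x,y) = −1, not a root of E_7: for y a root of E_7 (so orthogonal to x) that lattice is D_6 with 60 roots, contradicting |X_7| = 72 and making the uniqueness claim false. *)

(* Defs.v *)
From HB Require Import structures.
From mathcomp Require Import all_boot all_order all_algebra.
From mathcomp Require Import classical_sets functions cardinality reals.

Set Implicit Arguments.
Unset Strict Implicit.
Unset Printing Implicit Defensive.

Import Order.TTheory GRing.Theory Num.Theory.
Local Open Scope classical_set_scope.
Local Open Scope ring_scope.

Section Euclidean.
Context {R : realType}.

Definition inner {n : nat} (u v : 'rV[R]_n) : R := \sum_(i < n) u 0 i * v 0 i.

Definition norm2 {n : nat} (u : 'rV[R]_n) : R := inner u u.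

(* [usphere n] is the unit sphere of R^n, i.e. S^(n-1). *)
Definition usphere (n : nat) : set 'rV[R]_n := [set u | norm2 u = 1].

Definition inner_values {n : nat} (X : set 'rV[R]_n) : set R :=
  [set a | exists u v, [/\ X u, X v, u != v & a = inner u v]].

Definition orthocompl {n : nat} (x : 'rV[R]_n) : set 'rV[R]_n :=
  [set v | inner v x = 0].

Definition Zgenerated {n : nat} (G : set 'rV[R]_n) : set 'rV[R]_n :=
  smallest [set M | zmod_closed (mem M)] G.

Definition linear_span {n : nat} (G : set 'rV[R]_n) : set 'rV[R]_n :=
  smallest [set M | submod_closed (mem M)] G.

Definition roots_of {n : nat} (L : set 'rV[R]_n) : set 'rV[R]_n :=
  L `&` [set v | norm2 v = 2].

(* The orthogonal transformation is v |-> v *m Q, and [flip] selects the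
   vectors that are replaced by their opposites. *)
Definition equivalent {n : nat} (X X' : set 'rV[R]_n) : Prop :=
  exists (Q : 'M[R]_n) (flip : 'rV[R]_n -> bool),
    Q *m Q^T = 1%:M /\
    X' = [set (-1) ^+ flip v *: (v *m Q) | v in X].

Definition e8 (i : 'I_8) : 'rV[R]_8 := delta_mx 0 i.

Definition D8 : set 'rV[R]_8 :=
  Zgenerated [set v | exists i j, v = e8 i + e8 j \/ v = e8 i - e8 j].

Definition E8 : set 'rV[R]_8 :=
  Zgenerated (D8 `|` [set 2^-1 *: const_mx 1]).

Definition E7 (x : 'rV[R]_8) : set 'rV[R]_8 := E8 `&` orthocompl x.

(* This is the lattice E_6 when x and y are roots of E_8 with (x, y) = -1, i.e.
   when they generate a root lattice A_2.  For orthogonal roots x and y, in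
   particular for y a root of [E7 x], it is D_6 instead. *)
Definition E6 (x y : 'rV[R]_8) : set 'rV[R]_8 := E7 x `&` orthocompl y.

(* Only the values of phi on V matter. *)
Definition isometry_from {m n : nat} (V : set 'rV[R]_m)
    (phi : {linear 'rV[R]_m -> 'rV[R]_n}) : Prop :=
  {in V &, forall u v, inner (phi u) (phi v) = inner u v} /\
  phi @` V = setT.

Definition X7 (x y : 'rV[R]_8) (phi : {linear 'rV[R]_8 -> 'rV[R]_6}) :
    set 'rV[R]_7 :=
  [set (row_mx (Num.sqrt (2 / 5) *: phi z) (const_mx (Num.sqrt (1 / 5)))
          : 'rV[R]_(6 + 1)) | z in roots_of (E6 x y)].

End Euclidean.

Arguments usphere {R} n _.

(* Main.v *)
Require Import Defs.
From HB Require Import structures.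
From mathcomp Require Import all_boot all_order all_algebra.
From mathcomp Require Import zify lra finmap.
From mathcomp Require Import boolp classical_sets functions cardinality reals.

(** Rescale X so that its vectors have norm 5/2 and the inner products are
    ±1/2, ±3/2. If |X| >= 72, the frame inequality
    [(sum |x|^2)^2 <= dim * sum (x, y)^2] yields v in X with 21 vectors w in
    ±X such that (v, w) = 3/2. The differences r = v - w have norm 2 and
    (r, v) = 1. If all inner products of distinct r were 0 or 1, two more
    applications of the frame inequality would leave at most 20 of them. Hence
    some (r, r') = -1, and then e = v - r - r' has norm 1/2 and
    (x, e) = ±1/2 for all x in X: up to sign, x = e + r with r in a set of
    vectors of norm 2 of e^perp = R^6 with integral inner products.

    Such a set has at most 72 elements: for a root r the vectors x - r/2 with
    (x, r) = 1 span equiangular lines at angle arccos 1/3 in R^5, so that there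
    are at most 20 of them, and the frame inequality in R^6 concludes. In the
    case of equality all bounds are tight; counting then produces six roots
    with a prescribed Gram matrix of determinant 3, and by maximality the set
    consists of the 72 vectors of norm 2 in the lattice that they generate. Any
    two such sets, with their vectors e, are therefore isometric. *)

Set Implicit Arguments.
Unset Strict Implicit.
Unset Printing Implicit Defensive.

Import Order.TTheory GRing.Theory Num.Theory.
Local Open Scope ring_scope.

(** * Inner products and frames *)

Section Inner.
Context {R : realType} {n : nat}.
Implicit Types (u v w : 'rV[R]_n) (s : seq 'rV[R]_n) (a : R).

Lemma innerE u v : inner u v = (u *m v^T) 0 0.
Proof. by rewrite mxE; apply: eq_bigr => i _; rewrite mxE. Qed.

Lemma innerC u v : inner u v = inner v u.
Proof. by apply: eq_bigr => i _; rewrite mulrC. Qed.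

Lemma innerDl u v w : inner (u + v) w = inner u w + inner v w.
Proof. by rewrite !innerE mulmxDl mxE. Qed.

Lemma innerNl u w : inner (- u) w = - inner u w.
Proof. by rewrite !innerE mulNmx mxE. Qed.

Lemma innerZl a u w : inner (a *: u) w = a * inner u w.
Proof. by rewrite !innerE -scalemxAl mxE. Qed.

Lemma innerDr u v w : inner w (u + v) = inner w u + inner w v.
Proof. by rewrite innerC innerDl !(innerC w). Qed.

Lemma innerNr u w : inner w (- u) = - inner w u.
Proof. by rewrite innerC innerNl innerC. Qed.

Lemma innerZr a u w : inner w (a *: u) = a * inner w u.
Proof. by rewrite innerC innerZl innerC. Qed.

Definition innerB := (innerDl, innerDr, innerNl, innerNr, innerZl, innerZr).

Lemma inner0l w : inner 0 w = 0.
Proof. by rewrite -(scale0r 0) innerZl mul0r. Qed.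

Lemma inner_suml I (s : seq I) (F : I -> 'rV[R]_n) w :
  inner (\sum_(i <- s) F i) w = \sum_(i <- s) inner (F i) w.
Proof.
by elim: s => [|i s IHs]; rewrite ?big_nil ?inner0l// !big_cons innerDl IHs.
Qed.

Lemma inner_ge0 u : 0 <= inner u u.
Proof. by apply: sumr_ge0 => i _; rewrite -expr2 sqr_ge0. Qed.

Lemma inner_eq0 u : inner u u = 0 -> u = 0.
Proof.
move=> /eqP; rewrite psumr_eq0 => [/allP u0|i _]; last by rewrite -expr2 sqr_ge0.
apply/rowP => i; have := u0 i (mem_index_enum i).
by rewrite mulf_eq0 orbb mxE => /eqP.
Qed.

Lemma cauchy_schwarz u v : inner u v ^+ 2 <= inner u u * inner v v.
Proof.
have [v0|vn0] := eqVneq (inner v v) 0.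
  by rewrite (inner_eq0 v0) innerC !inner0l mulr0 expr0n.
have v_gt0 : 0 < inner v v by rewrite lt_neqAle eq_sym vn0 inner_ge0.
have := inner_ge0 (inner v v *: u - inner u v *: v).
rewrite !innerB (innerC v u).
set a := inner u u; set b := inner u v; set c := inner v v in v_gt0 *.
move=> H; have {H} : 0 <= c * (a * c - b ^+ 2) by apply: le_trans H _; lra.
by rewrite pmulr_rge0// subr_ge0.
Qed.

Lemma inner_inj u v : inner u u = inner v v -> inner u v = inner v v -> u = v.
Proof.
move=> uu uv; apply/eqP; rewrite -subr_eq0; apply/eqP; apply: inner_eq0.
by rewrite !innerB (innerC v u) uu uv; lra.
Qed.

End Inner.

Section Frame.
Context {R : realType} {n : nat}.
Implicit Types (s : seq 'rV[R]_n) (P : 'M[R]_n).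

Definition frame s : 'M[R]_n := \sum_(x <- s) x^T *m x.

Lemma mxtrace_sum I (r : seq I) (F : I -> 'M[R]_n) :
  \tr (\sum_(i <- r) F i) = \sum_(i <- r) \tr (F i).
Proof. exact: raddf_sum. Qed.

Lemma mxtrace_row (x y : 'rV[R]_n) : \tr (x^T *m y) = inner x y.
Proof. by rewrite mxtrace_mulC /mxtrace big_ord1 innerC innerE. Qed.

Lemma frame_trace s : \tr (frame s) = \sum_(x <- s) inner x x.
Proof. by rewrite mxtrace_sum; apply: eq_bigr => x _; rewrite mxtrace_row. Qed.

Lemma frame_sym s : (frame s)^T = frame s.
Proof.
rewrite /frame raddf_sum/=; apply: eq_bigr => x _.
by rewrite trmx_mul trmxK.
Qed.

Lemma frame_sqtrace s :
  \tr (frame s *m frame s) = \sum_(x <- s) \sum_(y <- s) inner x y ^+ 2.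
Proof.
rewrite {1}/frame mulmx_suml mxtrace_sum; apply: eq_bigr => x _.
rewrite /frame mulmx_sumr mxtrace_sum; apply: eq_bigr => y _.
rewrite mulmxA -(mulmxA x^T) [x *m y^T]mx11_scalar -innerE.
by rewrite mul_mx_scalar -scalemxAl mxtraceZ mxtrace_row expr2.
Qed.

(** For symmetric [A] this trace is the sum of the squares of all entries. *)
Lemma mxtrace_sqr_eq0 (A : 'M[R]_n) : A^T = A -> 0 <= \tr (A *m A) /\
  (\tr (A *m A) = 0 -> A = 0).
Proof.
move=> symA.
have trE : \tr (A *m A) = \sum_i \sum_j A i j ^+ 2.
  rewrite /mxtrace; apply: eq_bigr => i _; rewrite mxE; apply: eq_bigr => j _.
  by rewrite expr2 -{2}symA mxE.
have ge0 i : 0 <= \sum_j A i j ^+ 2 by apply: sumr_ge0 => j _; rewrite sqr_ge0.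
rewrite trE; split => [|/eqP]; first exact: sumr_ge0.
rewrite psumr_eq0 => [/allP A0|//]; apply/matrixP => i j; rewrite mxE.
have := A0 i (mem_index_enum i); rewrite /= psumr_eq0 => [/allP Ai0|k _].
  by apply/eqP; have := Ai0 j (mem_index_enum j); rewrite /= sqrf_eq0.
by rewrite sqr_ge0.
Qed.

(** [P] stands for the orthogonal projection onto a subspace of dimension [k] containing [s]. The
    trace of the square of [k *: frame s - T *: P] is [k * (k * Q - T ^+ 2)]; it is nonnegative, and
    it vanishes only for a tight frame of that subspace. *)
Lemma frame_bound s P (k : R) : 0 < k -> P^T = P -> \tr (P *m P) = k ->
    {in s, forall x, x *m P = x} ->
  let T := \sum_(x <- s) inner x x in
  let Q := \sum_(x <- s) \sum_(y <- s) inner x y ^+ 2 in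
  T ^+ 2 <= k * Q /\ (T ^+ 2 = k * Q -> k *: frame s = T *: P).
Proof.
move=> k0 symP trP sP T Q.
pose S := frame s; have SP : S *m P = S.
  rewrite /S /frame mulmx_suml big_seq [RHS]big_seq; apply: eq_bigr => x xs.
  by rewrite -mulmxA sP.
have PS : P *m S = S by rewrite -[S in LHS]frame_sym -symP -trmx_mul SP frame_sym.
pose A := k *: S - T *: P.
have symA : A^T = A by rewrite /A linearB/= !linearZ/= frame_sym symP.
have trA : \tr (A *m A) = k * (k * Q - T ^+ 2).
  rewrite /A mulmxBl !mulmxBr -!scalemxAl -!scalemxAr SP PS !linearB/= !mxtraceZ.
  by rewrite frame_sqtrace frame_trace trP -/T -/Q; lra.
have [A_ge0 A_eq0] := mxtrace_sqr_eq0 symA.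
split => [|TQ]; first by rewrite -subr_ge0 -(pmulr_rge0 _ k0) -trA.
by apply/subr0_eq/A_eq0; rewrite trA TQ subrr mulr0.
Qed.

Lemma inner_frame s (y z : 'rV[R]_n) :
  inner (y *m frame s) z = \sum_(x <- s) inner x y * inner x z.
Proof.
rewrite /frame mulmx_sumr inner_suml; apply: eq_bigr => x _.
by rewrite mulmxA [y *m x^T]mx11_scalar -innerE mul_scalar_mx innerZl (innerC y).
Qed.

Definition proj (w : 'rV[R]_n) : 'M[R]_n := (inner w w)^-1 *: (w^T *m w).

Lemma proj_sym w : (proj w)^T = proj w.
Proof. by rewrite /proj linearZ/= trmx_mul trmxK. Qed.

Lemma mul_proj (x w : 'rV[R]_n) : x *m proj w = (inner x w / inner w w) *: w.
Proof.
rewrite /proj -scalemxAr mulmxA [x *m w^T]mx11_scalar -innerE mul_scalar_mx.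
by rewrite scalerA mulrC.
Qed.

Lemma proj_mul (u w : 'rV[R]_n) :
  \tr (proj u *m proj w) = inner u w ^+ 2 / (inner u u * inner w w).
Proof.
rewrite {1}/proj -scalemxAl mxtraceZ -mulmxA mul_proj -scalemxAr mxtraceZ.
by rewrite mxtrace_row invfM expr2; lra.
Qed.

Lemma proj_trace (w : 'rV[R]_n) : inner w w != 0 -> \tr (proj w) = 1.
Proof. by move=> w0; rewrite /proj mxtraceZ mxtrace_row mulVf. Qed.

(** The trace of a projection is the dimension of its image, here a hyperplane; it serves as [k] in
    [frame_bound]. *)
Lemma compl1_trace (w : 'rV[R]_n) : inner w w != 0 ->
  \tr ((1%:M - proj w) *m (1%:M - proj w)) = n%:R - 1.
Proof.
move=> w0; rewrite mulmxBl !mulmxBr !mul1mx !mulmx1 !linearB/= mxtrace1.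
by rewrite proj_trace// proj_mul expr2 divff ?mulf_neq0//; lra.
Qed.

Lemma compl2_trace (u w : 'rV[R]_n) :
  inner u w = 0 -> inner u u != 0 -> inner w w != 0 ->
  \tr ((1%:M - proj u - proj w) *m (1%:M - proj u - proj w)) = n%:R - 2.
Proof.
move=> uw u0 w0.
rewrite !mulmxBl !mulmxBr !mul1mx !mulmx1 !linearB/= mxtrace1.
rewrite !proj_trace// !proj_mul (innerC w u) uw !expr2 !mul0r.
by rewrite !divff ?mulf_neq0//; lra.
Qed.

End Frame.

(** * Vectors with inner product 1 with a vector of norm 5/2 *)

Section Counting.
Context {R : realType} {I : eqType}.
Implicit Types (s u : seq I) (F : I -> R).

Lemma sumr_count s (b : pred I) : \sum_(x <- s) (b x)%:R = (count b s)%:R :> R.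
Proof. by rewrite -natr_sum -sum1_count [in RHS]big_mkcond. Qed.

Lemma sumr_seq_const s (a : R) : \sum_(x <- s) a = a * (size s)%:R.
Proof. by rewrite big_const_seq count_predT iter_addr_0 mulr_natr. Qed.

Lemma exists_ge_average s F (c : R) : s != [::] ->
  c * (size s)%:R <= \sum_(x <- s) F x -> exists2 x, x \in s & c <= F x.
Proof.
move=> s0 le_c; have [/hasP[x xs cx]|/hasPn Fc] := boolP (has (fun x => c <= F x) s).
  by exists x.
case: s s0 le_c Fc => // y s _; rewrite big_cons /= => le_c Fc.
have Fy : F y < c by rewrite ltNge Fc// mem_head.
have : \sum_(x <- s) F x <= \sum_(x <- s) c.
  rewrite big_seq [leRHS]big_seq ler_sum// => x xs.
  by rewrite ltW// ltNge Fc// inE xs orbT.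
by rewrite sumr_seq_const; move: le_c; rewrite -natr1; lra.
Qed.

Lemma eq_sumr_seq s F G : {in s, forall x, F x = G x} ->
  \sum_(x <- s) F x = \sum_(x <- s) G x.
Proof. by move=> FG; rewrite !big_seq; apply: eq_bigr. Qed.

Lemma exists_notin s u (b : pred I) : uniq s ->
  (size u < count b s)%N -> exists x, [/\ x \in s, b x & x \notin u].
Proof.
move=> uniq_s lt_us.
have [/hasP[x xs /andP[bx xu]]|/hasPn all_u] :=
  boolP (has (fun x => b x && (x \notin u)) s); first by exists x.
suff : (count b s <= size u)%N by rewrite leqNgt lt_us.
rewrite -size_filter; apply: uniq_leq_size; first exact: filter_uniq.
move=> x; rewrite mem_filter => /andP[bx xs].
by have := all_u x xs; rewrite bx/= negbK.
Qed.

End Counting.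

Section Star.
Context {R : realType}.
Implicit Types (r v x y : 'rV[R]_7) (t : seq 'rV[R]_7).

(** Sums a row of squared inner products. The diagonal entry is first counted as [p], whence
    [b x = false] and the correction [d - p]. *)
Lemma two_values_row_sum t (F : 'rV[R]_7 -> R) (b : pred 'rV[R]_7) x (p q d : R) :
    uniq t -> x \in t -> F x = d -> b x = false ->
    {in t, forall y, y != x -> F y = if b y then q else p} ->
  \sum_(y <- t) F y = p * (size t)%:R + (q - p) * (count b t)%:R + (d - p).
Proof.
move=> uniq_t xt Fx bx Fb.
rewrite (eq_sumr_seq (G := fun y => p + (q - p) * (b y)%:R + (d - p) * (y == x)%:R)).
  rewrite !big_split/= sumr_seq_const -!mulr_sumr !sumr_count.
  by rewrite (count_uniq_mem _ uniq_t) xt mulr1.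
move=> y yt; have [->|yx] := eqVneq y x.
  by rewrite Fx bx /=; lra.
by rewrite Fb//; case: (b y) => /=; lra.
Qed.

(* The family x - r/2 alone only gives [size t <= 16]; adding v - r/2 to it
   excludes 16. *)
Lemma star_neighbours_bound t r v :
    uniq t -> inner v v = 5 / 2 -> inner r r = 2 -> inner r v = 1 ->
    {in t, forall x, [/\ inner x x = 2, inner x v = 1 & inner x r = 1]} ->
    {in t &, forall x y, x != y -> inner x y = 0 \/ inner x y = 1} ->
  (size t < 16)%N.
Proof.
move=> uniq_t vv rr rv tP t01; rewrite ltnNge; apply/negP => B_ge.
set B := size t in B_ge.
pose w := v - 2^-1 *: r.
pose s := w :: [seq x - 2^-1 *: r | x <- t].
have r0 : inner r r != 0 by rewrite rr; lra.
have sP : {in s, forall x, x *m (1%:M - proj r) = x}.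
  suff sr : {in s, forall x, inner x r = 0}.
    by move=> x xs; rewrite mulmxBr mulmx1 mul_proj sr// mul0r scale0r subr0.
  move=> x; rewrite inE => /orP[/eqP->|/mapP[y yt ->]].
    by rewrite /w !innerB (innerC v) rv rr; lra.
  by have [_ _ yr] := tP y yt; rewrite !innerB yr rr; lra.
have symP : (1%:M - proj r)^T = 1%:M - proj r by rewrite linearB/= trmx1 proj_sym.
have k0 : (0 : R) < 7%:R - 1 by lra.
have [+ _] := frame_bound k0 symP (compl1_trace r0) sP.
have ww : inner w w = 2 by rewrite /w !innerB (innerC v) rv vv rr; lra.
have wt x : x \in t -> inner w (x - 2^-1 *: r) = 1 / 2.
  move=> /tP[xx xv xr].
  by rewrite /w !innerB (innerC v) xv rr (innerC r x) xr (innerC v) rv; lra.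
have xx x : x \in t -> inner (x - 2^-1 *: r) (x - 2^-1 *: r) = 3 / 2.
  by move=> /tP[xx xv xr]; rewrite !innerB (innerC r x) xr xx rr; lra.
have rows x : x \in t ->
    \sum_(y <- s) inner (x - 2^-1 *: r) y ^+ 2 = B%:R / 4 + 9 / 4.
  move=> xt; rewrite big_cons big_map innerC (wt _ xt).
  rewrite (@two_values_row_sum _ _ pred0 x (1 / 4) 0 (9 / 4))//.
  - by rewrite count_pred0 -/B; lra.
  - by rewrite xx//; lra.
  move=> y yt yx /=; have [_ _ xr] := tP x xt; have [_ _ yr] := tP y yt.
  rewrite !innerB xr (innerC r) yr rr.
  by have [|->|->] := t01 x y xt yt; rewrite 1?eq_sym//; lra.
have wrow : \sum_(x <- t) inner w (x - 2^-1 *: r) ^+ 2 = 1 / 4 * B%:R.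
  by rewrite -sumr_seq_const; apply: eq_sumr_seq => x /wt->; lra.
rewrite /= big_cons big_map big_cons big_map ww (eq_sumr_seq xx).
rewrite big_cons big_map (eq_sumr_seq rows) ww.
rewrite wrow !sumr_seq_const -/B => le_TQ.
(* The frame inequality amounts to [3 B^2 - 36 B - 80 <= 0], which fails for [B >= 16]. *)
have Bge : 0 <= (B%:R : R) - 16 by rewrite subr_ge0 ler_nat.
by have := mulr_ge0 Bge Bge; lra.
Qed.

(** Project 21 or more such vectors onto the complement of [v]. A row of squared inner products that
    is at least average belongs to some [r] having inner product 1 with at least 16 vectors of [t],
    against [star_neighbours_bound]. *)
Lemma star_bound t v :
    uniq t -> inner v v = 5 / 2 ->
    {in t, forall x, inner x x = 2 /\ inner x v = 1} ->
    {in t &, forall x y, x != y -> inner x y = 0 \/ inner x y = 1} ->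
  (size t <= 20)%N.
Proof.
move=> uniq_t vv tP t01; rewrite leqNgt; apply/negP => N_ge.
pose s := [seq x - (2 / 5) *: v | x <- t].
have v0 : inner v v != 0 by rewrite vv; lra.
have sP : {in s, forall x, x *m (1%:M - proj v) = x}.
  move=> _ /mapP[x xt ->]; have [_ xv] := tP x xt.
  have sv : inner (x - (2 / 5) *: v) v = 0 by rewrite !innerB xv vv; lra.
  by rewrite mulmxBr mulmx1 mul_proj sv mul0r scale0r subr0.
have symP : (1%:M - proj v)^T = 1%:M - proj v by rewrite linearB/= trmx1 proj_sym.
have k0 : (0 : R) < 7%:R - 1 by lra.
have [+ _] := frame_bound k0 symP (compl1_trace v0) sP.
pose b x := fun y => inner x y == 1.
have diag x : x \in t -> inner (x - (2 / 5) *: v) (x - (2 / 5) *: v) = 8 / 5.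
  by move=> /tP[xx xv]; rewrite !innerB (innerC v) xx xv vv; lra.
have rows x : x \in t -> \sum_(y <- s) inner (x - (2 / 5) *: v) y ^+ 2 =
    4 / 25 * (size t)%:R + 1 / 5 * (count (b x) t)%:R + 12 / 5.
  move=> xt; have [xx xv] := tP x xt.
  rewrite big_map (@two_values_row_sum _ _ (b x) x (4 / 25) (9 / 25) (64 / 25))//.
  - by lra.
  - by rewrite diag//; lra.
  - by rewrite /b xx; apply/negP => /eqP; lra.
  move=> y yt yx; have [_ yv] := tP y yt; rewrite !innerB xv (innerC v) yv vv /b.
  have [|->|->] := t01 x y xt yt; rewrite 1?eq_sym//.
    by case: eqP; lra.
  by rewrite eqxx; lra.
rewrite /= big_map (eq_sumr_seq diag) big_map (eq_sumr_seq rows).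
rewrite sumr_seq_const => le_TQ.
have Nge : (21 : R) <= (size t)%:R by rewrite ler_nat.
have t_neq0 : t != [::] by case: (t) N_ge.
(* [32 / 75] is [(8 / 5)^2 / 6]. Solving for the count gives at least [4 / 3 * size t - 12], hence
   16 when [size t >= 21]. *)
have [r rt B_ge] : exists2 r, r \in t & 32 / 75 * (size t)%:R <=
    4 / 25 * (size t)%:R + 1 / 5 * (count (b r) t)%:R + 12 / 5 :> R.
  by apply: exists_ge_average => //; nra.
have {}B_ge : (16 : R) <= (count (b r) t)%:R by lra.
have [rr rv] := tP r rt.
suff : (size (filter (b r) t) < 16)%N.
  by rewrite size_filter ltnNge; rewrite ler_nat in B_ge; rewrite B_ge.
apply: (star_neighbours_bound (r := r) (v := v)) => //.
- exact: filter_uniq.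
- move=> x; rewrite mem_filter => /andP[/eqP rx xt].
  by have [xx xv] := tP x xt; split; rewrite // innerC.
move=> x y; rewrite !mem_filter => /andP[_ xt] /andP[_ yt]; exact: t01.
Qed.

End Star.

(** * Roots having inner product 1 with a given root *)

Section Roots.
Context {R : realType}.
Implicit Types (e r x y z : 'rV[R]_7) (t : seq 'rV[R]_7).

Definition integral_roots e t : Prop :=
  [/\ uniq t, {in t, forall x, inner x x = 2 /\ inner x e = 0} &
      {in t &, forall x y, inner x y \is a Num.int}].

Lemma int_range (a : R) (m : nat) : a \is a Num.int -> - m%:R <= a <= m%:R ->
  exists2 k : int, a = k%:~R & (- m%:Z <= k <= m%:Z).
Proof.
move=> /intrP[k ->] /andP[]; rewrite -[m%:R]/(m%:~R) -intrN !ler_int => lek kle.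
by exists k => //; apply/andP.
Qed.

Lemma root_inner_cases {n} (x y : 'rV[R]_n) : inner x x = 2 -> inner y y = 2 ->
    inner x y \is a Num.int ->
  inner x y = 2 \/ inner x y = 1 \/ inner x y = 0 \/ inner x y = -1 \/
    inner x y = -2.
Proof.
move=> xx yy int_xy; have := cauchy_schwarz x y; rewrite xx yy => cs.
have [|k kE kle] := int_range (m := 2) int_xy; first by apply/andP; split; nra.
have : k = 2 \/ k = 1 \/ k = 0 \/ k = -1 \/ k = -2 by lia.
by rewrite kE; move=> [->|[->|[->|[->|->]]]]; tauto.
Qed.

Lemma perp2_fixed e r x : inner x e = 0 -> inner x r = 0 ->
  x *m (1%:M - proj e - proj r) = x.
Proof.
by move=> xe xr; rewrite !mulmxBr mulmx1 !mul_proj xe xr !mul0r !scale0r !subr0.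
Qed.

Definition pos a x := 0 < inner x a.

(** For [a] and [x] in a set of roots at inner product 1 with [r], and [x] other than [a] and
    [r - a], this is twice the inner product of [x - r/2] and [a - r/2]. *)
Definition chi a x : R := if pos a x then 1 else -1.

Section HalfRoots.
Variables (e r : 'rV[R]_7) (t : seq 'rV[R]_7).
Hypotheses (e_neq0 : inner e e != 0) (rr : inner r r = 2) (re : inner r e = 0).
Hypothesis roots_t : integral_roots e t.
Hypothesis t_r : {in t, forall x, inner x r = 1}.

Let h x := x - 2^-1 *: r.

Lemma half_inner x y : x \in t -> y \in t -> inner (h x) (h y) = inner x y - 1 / 2.
Proof. by move=> /t_r xr /t_r yr; rewrite /h !innerB xr (innerC r) yr rr; lra. Qed.

(** If the product is -1, then [r - x] has norm 2 and inner product 2 with [y], so they coincide.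
    The product -2 would mean [x = - y], while both have inner product 1 with [r]. *)
Lemma half_root_cases x y : x \in t -> y \in t ->
  [\/ y = x, inner x y = 1, inner x y = 0 | y = r - x].
Proof.
have [_ tP t_int] := roots_t => xt yt.
have [xx _] := tP x xt; have [yy _] := tP y yt.
have [xy|[xy|[xy|[xy|xy]]]] := root_inner_cases xx yy (t_int x y xt yt).
- by constructor 1; apply: inner_inj; rewrite ?xx ?yy// innerC.
- by constructor 2.
- by constructor 3.
- constructor 4; have norm_rx : inner (r - x) (r - x) = 2.
    by rewrite !innerB (innerC r x) rr xx t_r//; lra.
  apply: inner_inj; rewrite norm_rx ?yy//.
  by rewrite !innerB t_r// (innerC y x) xy; lra.
have xNy : x = - y by apply: inner_inj; rewrite !innerB ?xx ?yy ?xy; lra.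
by have := t_r xt; rewrite xNy innerNl t_r//; lra.
Qed.

Let count_opp := count (fun x => r - x \in t) t.

(** The vectors [h x] have norm 3/2 and mutual inner products ±1/2, except that [r - x] yields the
    opposite of [h x]. A row of [Q] is therefore [size t / 4 + 2], plus 2 if [r - x] is present. All
    of them lie in the complement of [e] and [r], of dimension 5. *)
Lemma half_frame :
  let T := \sum_(x <- map h t) inner x x in
  let Q := \sum_(x <- map h t) \sum_(y <- map h t) inner x y ^+ 2 in
  [/\ T = 3 / 2 * (size t)%:R,
      Q = (size t)%:R ^+ 2 / 4 + 2 * (size t)%:R + 2 * count_opp%:R,
      T ^+ 2 <= 5 * Q &
      T ^+ 2 = 5 * Q -> 5 *: frame (map h t) = T *: (1%:M - proj e - proj r)].
Proof.
have [uniq_t tP t_int] := roots_t => T Q.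
have r_neq0 : inner r r != 0 by rewrite rr pnatr_eq0.
have TE : T = 3 / 2 * (size t)%:R.
  rewrite /T big_map -sumr_seq_const; apply: eq_sumr_seq => x xt.
  by rewrite half_inner//; have [-> _] := tP x xt; lra.
have QE : Q = (size t)%:R ^+ 2 / 4 + 2 * (size t)%:R + 2 * count_opp%:R.
  rewrite /Q big_map.
  rewrite (eq_sumr_seq (G := fun x => (1 / 4 * (size t)%:R + 2)
     + 2 * (r - x \in t)%:R)); last first.
    move=> x xt; rewrite big_map.
    rewrite (eq_sumr_seq (G := fun y => 1 / 4 + 2 * (y == x)%:R
       + 2 * (y == r - x)%:R)); last first.
      move=> y yt; rewrite half_inner//; have [xx _] := tP x xt.
      have x_rx : (x == r - x) = false.
        by apply/eqP => xrx; have := xx; rewrite {2}xrx !innerB xx t_r//; lra.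
      have neq u : inner x y <> inner x u -> (y == u) = false.
        by move=> xyu; apply/eqP => yE; apply: xyu; rewrite yE.
      have xrx : inner x (r - x) = -1 by rewrite !innerB xx t_r//; lra.
      case: (half_root_cases xt yt) => [->|xy|xy|->].
      - by rewrite eqxx x_rx xx /=; lra.
      - have -> := neq x; last by rewrite xy xx; lra.
        by have -> := neq (r - x); rewrite xy ?xrx /=; lra.
      - have -> := neq x; last by rewrite xy xx; lra.
        by have -> := neq (r - x); rewrite xy ?xrx /=; lra.
      - by rewrite eqxx eq_sym x_rx xrx /=; lra.
    rewrite !big_split/= sumr_seq_const -!mulr_sumr !sumr_count.
    by rewrite !(count_uniq_mem _ uniq_t) xt /=; lra.
  by rewrite big_split/= sumr_seq_const -mulr_sumr sumr_count -/count_opp; lra.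
have sP : {in map h t, forall x, x *m (1%:M - proj e - proj r) = x}.
  move=> _ /mapP[x xt ->]; have [_ xe] := tP x xt.
  by apply: perp2_fixed; rewrite /h !innerB; [rewrite xe re|rewrite t_r// rr]; lra.
have symP : (1%:M - proj e - proj r)^T = 1%:M - proj e - proj r.
  by rewrite !linearB/= trmx1 !proj_sym.
have k0 : (0 : R) < 7%:R - 2 by lra.
have er : inner e r = 0 by rewrite innerC.
have := frame_bound k0 symP (compl2_trace er e_neq0 r_neq0) sP.
rewrite -/T -/Q (_ : 7%:R - 2 = 5 :> R); last by lra.
by case.
Qed.

(** Since [count_opp] is at most [N = size t], the frame inequality yields [N^2 <= 20 N]. *)
Lemma half_roots_bound : (size t <= 20)%N.
Proof.
have [TE QE + _] := half_frame; rewrite TE QE => le_TQ.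
have : (count_opp%:R : R) <= (size t)%:R by rewrite ler_nat count_size.
rewrite leqNgt => le_c; apply/negP => N_ge.
have {}N_ge : (21 : R) <= (size t)%:R by rewrite ler_nat.
by have := mulr_ge0 (_ : 0 <= (size t)%:R :> R) (_ : 0 <= (size t)%:R - 21 :> R);
   rewrite ler0n subr_ge0 => /(_ isT N_ge); lra.
Qed.

Hypothesis size_t : size t = 20%N.

Lemma half_roots_opp : {in t, forall x, r - x \in t}.
Proof.
have [TE QE + _] := half_frame; rewrite TE QE size_t => le_TQ.
have c_le : (count_opp <= 20)%N by rewrite -size_t count_size.
have : (20 : R) <= count_opp%:R by lra.
rewrite ler_nat => c_ge; apply/allP; rewrite all_count size_t eqn_leq.
by rewrite -/count_opp c_le.
Qed.

(** Now [T = 30] and [Q = 180], so that [T ^+ 2 = 5 * Q] and the frame is 6 times the projection. *)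
Lemma half_roots_tight x y : inner x e = 0 -> inner x r = 0 ->
  \sum_(z <- t) inner (h z) x * inner (h z) y = 6 * inner x y.
Proof.
move=> xe xr; have [TE QE _ eqF] := half_frame.
have c20 : count_opp = 20%N.
  by rewrite -size_t; apply/eqP; rewrite -all_count; apply/allP/half_roots_opp.
have {eqF} : 5 *: frame (map h t) = 30 *: (1%:M - proj e - proj r).
  by rewrite eqF TE ?QE size_t ?c20; [congr (_ *: _)|]; lra.
move=> /(congr1 (fun A => inner (x *m A) y)).
by rewrite -!scalemxAr perp2_fixed// !innerZl inner_frame big_map; lra.
Qed.

(* The odd moments of the signs [chi] vanish because of this symmetry, and the
   second moments are given by [half_roots_tight]. *)
Lemma chi_opp a x : a \in t -> x \in t -> chi a (r - x) = - chi a x.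
Proof.
have [_ tP _] := roots_t => at_ xt.
have [xx _] := tP x xt.
have [aa _] := tP a at_; have ar := t_r at_.
have rxa : inner (r - x) a = 1 - inner x a by rewrite !innerB (innerC r) ar; lra.
have : 1 <= inner x a \/ inner x a <= 0.
  case: (half_root_cases at_ xt) => [->|xa|xa|->].
  - by left; rewrite aa; lra.
  - by left; rewrite innerC xa; lra.
  - by right; rewrite innerC xa; lra.
  - by right; rewrite !innerB (innerC r) ar aa; lra.
rewrite /chi /pos rxa => -[xa|xa].
  by rewrite (lt_le_trans ltr01 xa) ltNge subr_le0 xa.
by rewrite [in RHS]ltNge xa opprK subr_gt0 (le_lt_trans xa ltr01).
Qed.

Lemma sum_opp (F : 'rV[R]_7 -> R) :
  \sum_(x <- t) F x = \sum_(x <- t) F (r - x).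
Proof.
have [uniq_t _ _] := roots_t.
have inj : injective (fun x => r - x) by move=> x y /addrI/oppr_inj.
rewrite -[RHS](big_map (fun x => r - x) xpredT); apply: perm_big.
apply: uniq_perm; rewrite ?map_inj_uniq// => x; apply/idP/mapP.
  by move=> xt; exists (r - x); rewrite ?half_roots_opp// subKr.
by case=> y yt ->; exact: half_roots_opp.
Qed.

Lemma sum_chi a : a \in t -> \sum_(x <- t) chi a x = 0.
Proof.
move=> at_; have := sum_opp (chi a).
by rewrite (eq_sumr_seq (fun x => @chi_opp a x at_)) sumrN; lra.
Qed.

Lemma sum_chi3 a b c : a \in t -> b \in t -> c \in t ->
  \sum_(x <- t) chi a x * chi b x * chi c x = 0.
Proof.
move=> at_ bt ct; have := sum_opp (fun x => chi a x * chi b x * chi c x).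
rewrite (eq_sumr_seq (F := fun x => chi a (r - x) * _ * _)
  (G := fun x => - (chi a x * chi b x * chi c x))); last first.
  by move=> x xt; rewrite !chi_opp//; lra.
by rewrite sumrN; lra.
Qed.

Lemma sum_pred1 (F : 'rV[R]_7 -> R) a : a \in t ->
  \sum_(x <- t) F x * (x == a)%:R = F a.
Proof.
have [uniq_t _ _] := roots_t => at_.
rewrite (eq_sumr_seq (G := fun x => F a * (x == a)%:R)); last first.
  by move=> x _; have [->|_] := eqVneq x a; rewrite ?mulr0.
by rewrite -mulr_sumr sumr_count (count_uniq_mem _ uniq_t) at_ mulr1.
Qed.

(** At [x = a] and [x = r - a] the inner product is ±3/2 instead of ±1/2; the two indicators
    compensate for this. *)
Lemma chiE a x : a \in t -> x \in t ->
  chi a x = 2 * inner (h x) (h a) - 2 * (x == a)%:R + 2 * (x == r - a)%:R.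
Proof.
have [_ tP _] := roots_t => at_ xt; have [aa _] := tP a at_.
have ar := t_r at_.
have neq u : inner x a <> inner u a -> (x == u) = false.
  by move=> xu; apply/eqP => xE; apply: xu; rewrite xE.
have raa : inner (r - a) a = -1 by rewrite !innerB (innerC r) aa ar; lra.
have ara : (a == r - a) = false.
  by apply/eqP => aE; move: raa; rewrite -aE aa; lra.
rewrite half_inner// /chi /pos.
case: (half_root_cases at_ xt) => [->|xa|xa|->].
- by rewrite eqxx ara aa ltr0n /=; lra.
- rewrite innerC in xa; rewrite !neq ?raa ?aa xa; [|lra..].
  by rewrite ltr01 /=; lra.
- rewrite innerC in xa; rewrite !neq ?raa ?aa xa; [|lra..].
  by rewrite ltxx /=; lra.
- by rewrite eqxx eq_sym ara raa oppr_gt0 ltr10 /=; lra.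
Qed.

(** Replacing one sign at a time by [chiE] reduces the sum to the tight frame identity and a few
    boundary terms. *)
Lemma sum_chi2 a b : a \in t -> b \in t -> inner a b = 1 ->
  \sum_(x <- t) chi a x * chi b x = 4.
Proof.
have [uniq_t tP _] := roots_t => at_ bt ab.
have [aa ae] := tP a at_; have ar := t_r at_.
have chi_ab : chi a b = 1 by rewrite /chi /pos innerC ab ltr01.
have sum1 : \sum_(x <- t) chi a x * inner (h x) (h b) = 4.
  rewrite (eq_sumr_seq (G := fun x => 2 * (inner (h x) (h a) * inner (h x) (h b))
    - 2 * (inner (h x) (h b) * (x == a)%:R)
    + 2 * (inner (h x) (h b) * (x == r - a)%:R))); last first.
    by move=> x xt; rewrite chiE//; lra.
  rewrite !big_split/= sumrN -!mulr_sumr !sum_pred1 ?half_roots_opp//.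
  rewrite half_roots_tight; last 2 first.
  - by rewrite /h !innerB ae re; lra.
  - by rewrite /h !innerB ar rr; lra.
  by rewrite !half_inner ?half_roots_opp// !innerB ab (innerC r) (t_r bt); lra.
rewrite (eq_sumr_seq (G := fun x => 2 * (chi a x * inner (h x) (h b))
    - 2 * (chi a x * (x == b)%:R) + 2 * (chi a x * (x == r - b)%:R))); last first.
  by move=> x xt; rewrite (chiE bt)//; lra.
rewrite !big_split/= sumrN -!mulr_sumr !sum_pred1 ?half_roots_opp//.
by rewrite chi_opp// sum1 chi_ab; lra.
Qed.

Lemma chi_pos a x : (pos a x)%:R = (1 + chi a x) / 2 :> R.
Proof. by rewrite /chi; case: (pos a x) => /=; lra. Qed.

Lemma count_pos1 a : a \in t -> count (pos a) t = 10%N.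
Proof.
move=> at_; apply/eqP; rewrite -(eqr_nat R) -sumr_count; apply/eqP.
rewrite (eq_sumr_seq (G := fun x => 1 / 2 + 1 / 2 * chi a x)); last first.
  by move=> x _; rewrite chi_pos; lra.
by rewrite big_split/= sumr_seq_const -mulr_sumr sum_chi// size_t; lra.
Qed.

Lemma count_pos2 a b : a \in t -> b \in t -> inner a b = 1 ->
  count (fun x => pos a x && pos b x) t = 6%N.
Proof.
move=> at_ bt ab; apply/eqP; rewrite -(eqr_nat R) -sumr_count; apply/eqP.
rewrite (eq_sumr_seq (G := fun x => 1 / 4 + 1 / 4 * chi a x + 1 / 4 * chi b x
   + 1 / 4 * (chi a x * chi b x))); last first.
  by move=> x _; rewrite -mulnb natrM !chi_pos; lra.
by rewrite !big_split/= sumr_seq_const -!mulr_sumr !sum_chi// sum_chi2// size_t; lra.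
Qed.

(** In the product of the three indicators [(1 + chi) / 2] the terms of odd degree sum to 0 and each
    pair of signs to 4, leaving [(20 + 3 * 4) / 8]. *)
Lemma count_pos3 a b c : a \in t -> b \in t -> c \in t ->
    inner a b = 1 -> inner a c = 1 -> inner b c = 1 ->
  count (fun x => [&& pos a x, pos b x & pos c x]) t = 4%N.
Proof.
move=> at_ bt ct ab ac bc; apply/eqP; rewrite -(eqr_nat R) -sumr_count; apply/eqP.
rewrite (eq_sumr_seq (G := fun x => 1 / 8 + 1 / 8 * chi a x + 1 / 8 * chi b x
   + 1 / 8 * chi c x + 1 / 8 * (chi a x * chi b x) + 1 / 8 * (chi a x * chi c x)
   + 1 / 8 * (chi b x * chi c x) + 1 / 8 * (chi a x * chi b x * chi c x)));
  last first.
  by move=> x _; rewrite -!mulnb !natrM !chi_pos; lra.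
rewrite !big_split/= sumr_seq_const -!mulr_sumr !sum_chi// !sum_chi2// sum_chi3//.
by rewrite size_t; lra.
Qed.

Lemma pos_neq a x : a \in t -> x \in t -> pos a x -> x != a -> inner a x = 1.
Proof.
have [_ tP _] := roots_t => at_ xt; have [aa _] := tP a at_.
rewrite /pos => + xa; have [xE|//|xa0|->] := half_root_cases at_ xt.
- by rewrite xE eqxx in xa.
- by rewrite innerC xa0 ltxx.
by rewrite !innerB (innerC r) t_r// aa; lra.
Qed.

(** In the model of [t] by the 3-subsets of {1,...,6}, where the inner product is the size of the
    intersection minus 1, the five roots are 123, 124, 125, 126, 134. They are chosen greedily: the
    counts 10, 6, 4 and 6 always exceed the number of roots already taken. *)
Lemma half_roots_e6 : exists r1 p q q' z,
  [/\ [/\ r1 \in t, p \in t, q \in t, q' \in t & z \in t],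
      [/\ inner r1 p = 1, inner r1 q = 1, inner r1 q' = 1 & inner r1 z = 1],
      [/\ inner p q = 1, inner p q' = 1 & inner p z = 1] &
      [/\ inner q q' = 1, inner q z = 0 & inner q' z = 0]].
Proof.
have [uniq_t tP _] := roots_t.
have [r1 r1t] : exists r1, r1 \in t.
  by case: (t) size_t => // r1 s _; exists r1; rewrite mem_head.
have [p [pt p1]] : exists p, [/\ p \in t, pos r1 p & p \notin [:: r1]].
  by apply: exists_notin; rewrite ?count_pos1.
rewrite !inE => /(pos_neq r1t pt p1) r1p.
have [q [qt /andP[q1 q2]]] : exists q, [/\ q \in t, pos r1 q && pos p q
    & q \notin [:: r1; p]].
  by apply: exists_notin; rewrite ?count_pos2.
rewrite !inE negb_or => /andP[/(pos_neq r1t qt q1) r1q /(pos_neq pt qt q2) pq].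
have [q' [q't /and3P[q'1 q'2 q'3]]] : exists q', [/\ q' \in t,
    [&& pos r1 q', pos p q' & pos q q'] & q' \notin [:: r1; p; q]].
  by apply: exists_notin; rewrite ?count_pos3.
rewrite !inE !negb_or => /and3P[/(pos_neq r1t q't q'1) r1q'
  /(pos_neq pt q't q'2) pq' /(pos_neq qt q't q'3) qq'].
have [z [zt /andP[z1 z2]]] : exists z, [/\ z \in t, pos r1 z && pos p z
    & z \notin [:: r1; p; q; q']].
  by apply: exists_notin; rewrite ?count_pos2.
rewrite !inE !negb_or => /and4P[zr1 zp zq zq'].
have r1z := pos_neq r1t zt z1 zr1; have pz := pos_neq pt zt z2 zp.
have inner_neq u v : u \in t -> inner u v = 1 -> u != v.
  move=> /tP[uu _] uv; apply/eqP => uE.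
  by move: uv; rewrite -uE uu; lra.
have pos1 u v : inner u v = 1 -> pos u v by rewrite /pos innerC => ->.
have pos_id u : u \in t -> pos u u by move=> /tP[uu _]; rewrite /pos uu.
(* Exactly four roots have positive inner product with each of [r1], [p] and [u]. These are [r1],
   [p], [u] and [v], so [z] cannot be a fifth. *)
have not_pos u v : u \in t -> v \in t -> inner r1 u = 1 -> inner p u = 1 ->
    inner r1 v = 1 -> inner p v = 1 -> inner u v = 1 -> v != z -> z != u ->
    ~~ pos u z.
  move=> ut vt r1u pu r1v pv uv vz zu; apply/negP => uz.
  have : (size [:: r1; p; u; v; z] <=
      size (filter (fun x => [&& pos r1 x, pos p x & pos u x]) t))%N.
    apply: uniq_leq_size.
      by rewrite /= !inE !negb_or vz (eq_sym u z) zu !inner_neq.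
    move=> x; rewrite !inE mem_filter => /or4P[/eqP->|/eqP->|/eqP->|].
    - by rewrite !pos_id ?pos1// innerC.
    - by rewrite !pos_id ?pos1// innerC.
    - by rewrite !pos_id ?pos1// innerC.
    by move=> /orP[/eqP->|/eqP->]; rewrite ?z1 ?z2 ?uz ?pos1.
  by rewrite size_filter count_pos3.
have zero u : u \in t -> inner p u = 1 -> z != u -> ~~ pos u z -> inner u z = 0.
  move=> ut pu zu; rewrite /pos innerC.
  have [zE|->|//|zE] := half_root_cases ut zt; first by rewrite zE eqxx in zu.
    by rewrite ltr01.
  (* The case [z = r - u] would give [inner p z = 1 - 1 = 0]. *)
  by move: pz; rewrite zE !innerB t_r// pu; lra.
exists r1, p, q, q', z; split => //; split => //; apply: zero => //.
  by apply: (not_pos q q') => //; rewrite eq_sym.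
by apply: (not_pos q' q) => //; [rewrite innerC|rewrite eq_sym].
Qed.

End HalfRoots.
End Roots.

(** * Maximal sets of roots in a hyperplane of R^7 *)

Section E6Roots.
Context {R : realType}.
Implicit Types (e r x y z : 'rV[R]_7) (t b : seq 'rV[R]_7).

Lemma integral_roots_filter e t (a : pred 'rV[R]_7) :
  integral_roots e t -> integral_roots e (filter a t).
Proof.
case=> uniq_t tP t_int; split; first exact: filter_uniq.
  by move=> x; rewrite mem_filter => /andP[_ /tP].
by move=> x y; rewrite !mem_filter => /andP[_ xt] /andP[_ yt]; apply: t_int.
Qed.

Definition half_roots r t := [seq x <- t | inner x r == 1].

Lemma half_roots_size e r t : inner e e != 0 -> integral_roots e t ->
  inner r r = 2 -> inner r e = 0 -> (size (half_roots r t) <= 20)%N.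
Proof.
move=> e0 roots_t rr re; apply: (half_roots_bound e0 rr re).
  exact: integral_roots_filter.
by move=> x; rewrite mem_filter => /andP[/eqP].
Qed.

Lemma sum_inner_sqr e r t : integral_roots e t -> r \in t ->
  \sum_(x <- t) inner r x ^+ 2 = (size (half_roots r t))%:R
    + (size (half_roots (- r) t))%:R + 4 + 4 * (- r \in t)%:R.
Proof.
move=> [uniq_t tP t_int] rt; have [rr _] := tP r rt.
rewrite (eq_sumr_seq (G := fun x => (inner x r == 1)%:R + (inner x (- r) == 1)%:R
    + 4 * (x == r)%:R + 4 * (x == - r)%:R)).
  rewrite !big_split/= -!mulr_sumr !sumr_count !(count_uniq_mem _ uniq_t) rt.
  by rewrite -!size_filter mulr1.
move=> x xt; have [xx _] := tP x xt.
have neq u : inner r x <> inner r u -> (x == u) = false.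
  by move=> xru; apply/eqP => xE; apply: xru; rewrite xE.
have rNr : inner r (- r) = -2 by rewrite innerNr rr.
have [rx|[rx|[rx|[rx|rx]]]] := root_inner_cases rr xx (t_int r x rt xt).
- have -> : x = r by apply: inner_inj; rewrite ?xx ?rr// innerC.
  rewrite eqxx rr innerNr rr (_ : (r == - r) = false); last first.
    by apply/eqP => rE; move: rNr; rewrite -rE rr; lra.
  have /negbTE-> : (2 : R) != 1 by lra.
  have /negbTE-> : - (2 : R) != 1 by lra.
  by rewrite /=; lra.
- rewrite innerNr (innerC x) rx eqxx !neq ?rNr ?rr ?rx; [|lra..].
  have /negbTE-> : - (1 : R) != 1 by lra.
  by rewrite /=; lra.
- rewrite innerNr (innerC x) rx !neq ?rNr ?rr ?rx; [|lra..].
  have /negbTE-> : (0 : R) != 1 by lra.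
  have /negbTE-> : - (0 : R) != 1 by lra.
  by rewrite /=; lra.
- rewrite innerNr (innerC x) rx opprK eqxx !neq ?rNr ?rr ?rx; [|lra..].
  have /negbTE-> : - (1 : R) != 1 by lra.
  by rewrite /=; lra.
- have -> : x = - r.
    by apply: inner_inj; rewrite !innerB rr ?xx ?(innerC x r) ?rx; lra.
  rewrite eqxx !innerB rr (_ : (- r == r) = false); last first.
    by apply/eqP => rE; move: rNr; rewrite rE rr; lra.
  have /negbTE-> : - - (2 : R) != 1 by lra.
  have /negbTE-> : - (2 : R) != 1 by lra.
  by rewrite /=; lra.
Qed.

(** The frame inequality in dimension 6 provides a root whose row is at least [2 / 3 * size t],
    hence at least 48. By [sum_inner_sqr] no row exceeds [20 + 20 + 4 + 4 = 48], so all these bounds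
    are attained. *)
Lemma integral_roots_max e t : inner e e != 0 -> integral_roots e t ->
    (72 <= size t)%N ->
  size t = 72%N /\ exists2 r, r \in t & size (half_roots r t) = 20%N.
Proof.
move=> e0 roots_t t_ge; have [uniq_t tP t_int] := roots_t.
have sP : {in t, forall x, x *m (1%:M - proj e) = x}.
  by move=> x /tP[_ xe]; rewrite mulmxBr mulmx1 mul_proj xe mul0r scale0r subr0.
have symP : (1%:M - proj e)^T = 1%:M - proj e by rewrite linearB/= trmx1 proj_sym.
have k0 : (0 : R) < 7%:R - 1 by lra.
have [+ _] := frame_bound k0 symP (compl1_trace e0) sP.
rewrite /= (eq_sumr_seq (G := fun=> 2)) ?sumr_seq_const; last first.
  by move=> x /tP[].
move=> le_TQ; have Nge : (72 : R) <= (size t)%:R by rewrite ler_nat.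
have [r rt r_ge] : exists2 r, r \in t &
    2 / 3 * (size t)%:R <= \sum_(x <- t) inner r x ^+ 2.
  apply: exists_ge_average; first by case: (t) t_ge.
  by nra.
have [rr re] := tP r rt.
rewrite (sum_inner_sqr roots_t rt) in r_ge.
have Nrr : inner (- r) (- r) = 2 by rewrite !innerB rr; lra.
have Nre : inner (- r) e = 0 by rewrite innerNl re oppr0.
have c1 := half_roots_size e0 roots_t rr re.
have c2 := half_roots_size e0 roots_t Nrr Nre.
have c1R : (size (half_roots r t))%:R <= (20 : R) by rewrite ler_nat.
have c2R : (size (half_roots (- r) t))%:R <= (20 : R) by rewrite ler_nat.
have c3R : (- r \in t)%:R <= (1 : R) by case: (_ \in _) => /=; lra.
split.
  apply/eqP; rewrite eqn_leq t_ge andbT -(ler_nat R); lra.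
exists r => //; apply/eqP; rewrite eqn_leq c1 -(ler_nat R); lra.
Qed.

(* In the model of E6 by r and the 3-subsets of {1,...,6} this is the Gram
   matrix of r, 123, 124, 125, 126, 134. *)
Definition e6_gram : seq (seq int) :=
  [:: [:: 2; 1; 1; 1; 1; 1];
      [:: 1; 2; 1; 1; 1; 1];
      [:: 1; 1; 2; 1; 1; 1];
      [:: 1; 1; 1; 2; 1; 0];
      [:: 1; 1; 1; 1; 2; 0];
      [:: 1; 1; 1; 0; 0; 2]].

Definition e6_basis b : Prop :=
  [seq [seq inner x y | y <- b] | x <- b] = map (map intr) e6_gram.

Lemma integral_roots_e6_basis e t : inner e e != 0 -> integral_roots e t ->
    (72 <= size t)%N ->
  exists2 b, {subset b <= t} & e6_basis b.
Proof.
move=> e0 roots_t t_ge; have [_ tP _] := roots_t.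
have [_ [r rt size_r]] := integral_roots_max e0 roots_t t_ge.
have [rr re] := tP r rt.
have t_r : {in half_roots r t, forall x, inner x r = 1}.
  by move=> x; rewrite mem_filter => /andP[/eqP].
have [r1 [p [q [q' [z [[]]]]]]] := half_roots_e6 e0 rr re
  (integral_roots_filter _ roots_t) t_r size_r.
rewrite !mem_filter => /andP[/eqP r1r r1t] /andP[/eqP pr pt] /andP[/eqP qr qt].
move=> /andP[/eqP q'r q't] /andP[/eqP zr zt].
move=> [r1p r1q r1q' r1z] [pq pq' pz] [qq' qz q'z].
have norm x : x \in t -> inner x x = 2 by move=> /tP[].
exists [:: r; r1; p; q; q'; z].
  by apply/allP; rewrite /= rt r1t pt qt q't zt.
rewrite /e6_basis /= !norm// (innerC r r1) (innerC r p) (innerC r q) (innerC r q').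
rewrite (innerC r z) r1r pr qr q'r zr r1p r1q r1q' r1z (innerC p r1) (innerC q r1).
rewrite (innerC q' r1) (innerC z r1) r1p r1q r1q' r1z pq pq' pz (innerC q p).
rewrite (innerC q' p) (innerC z p) pq pq' pz (innerC q' q) (innerC z q).
by rewrite (innerC z q') qq' qz q'z.
Qed.

End E6Roots.

(** * Integer coordinates of the 72 roots of E6 *)

Definition int_dot (c d : seq int) : int :=
  foldr (fun p s => p.1 * p.2 + s) 0 (zip c d).

Definition e6_form (c d : seq int) : int :=
  int_dot c [seq int_dot d g | g <- e6_gram].

Definition seq_add (c d : seq int) : seq int := [seq p.1 + p.2 | p <- zip c d].

Definition e6_units : seq (seq int) :=
  let u := [seq [seq if i == j then 1 else 0 | j <- iota 0 6] | i <- iota 0 6] in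
  u ++ [seq [seq - k | k <- c] | c <- u].

(** The sum of two roots with inner product -1 is again a root. Starting from the basis and its
    opposites, six rounds of adding such vectors reach all 72. *)
Fixpoint e6_closure (n : nat) : seq (seq int) :=
  if n is n'.+1 then
    let l := e6_closure n' in
    undup (l ++ [seq seq_add c d | c <- l, d <- [seq d <- e6_units | e6_form c d == -1]])
  else e6_units.

Definition e6_list : seq (seq int) := Eval vm_compute in e6_closure 6.

(** The list is sealed behind an opaque proof, so that later arguments rely on these four properties
    alone and never unfold it. The last one makes distinct coordinates represent distinct
    vectors. *)
Lemma e6_form_roots : {l : seq (seq int) | [/\ size l = 72%N, uniq l,
  {in l, forall c, e6_form c c = 2} &
  {in l &, forall c d, e6_form c d = 2 -> c = d}]}.
Proof.
exists e6_list; set l := e6_list.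
have formE : all (fun c => e6_form c c == 2) l by vm_compute.
have form_inj : all (fun c => all (fun d => (e6_form c d == 2) ==> (c == d)) l) l.
  by vm_compute.
have size_l : size l == 72%N by vm_compute.
have uniq_l : uniq l by vm_compute.
split; [exact: (eqP size_l)|exact: uniq_l| |].
  by move=> c /(allP formE)/eqP.
move=> c d cl dl cd; have := allP (allP form_inj c cl) d dl.
by move=> /implyP/(_ (introT eqP cd))/eqP.
Qed.

Definition e6_roots : seq (seq int) := sval e6_form_roots.

(** Equality of the Gram matrices is what makes the change of basis [invmx B *m B'] orthogonal. *)
Lemma gram_isometry {R : realType} {n : nat} (B B' : 'M[R]_n) :
    B *m B^T = B' *m B'^T -> B \in unitmx ->
  exists2 Q : 'M[R]_n, Q *m Q^T = 1%:M & B *m Q = B'.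
Proof.
move=> BB unitB; exists (invmx B *m B'); last by rewrite mulKVmx.
rewrite trmx_mul trmx_inv mulmxA -(mulmxA _ B') -BB mulmxA mulVmx// mul1mx.
by rewrite mulmxV// unitmx_tr.
Qed.

(** * Uniqueness of maximal root sets up to isometry *)

Section LinComb.
Context {R : realType}.
Implicit Types (e x y : 'rV[R]_7) (t b : seq 'rV[R]_7) (c d g : seq int).

Definition lincomb c b : 'rV[R]_7 :=
  foldr (fun p v => p.1%:~R *: p.2 + v) 0 (zip c b).

Lemma inner_lincomb b y g c : [seq inner x y | x <- b] = map intr g ->
  inner (lincomb c b) y = (int_dot c g)%:~R.
Proof.
rewrite /lincomb /int_dot.
elim: c b g => [|k c IHc] [|x b] [|m g]//=; rewrite ?inner0l//.
by case=> xy /IHc IH; rewrite innerDl innerZl xy IH intrD intrM.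
Qed.

Lemma inner_lincombs b s (M : seq (seq int)) d :
    [seq [seq inner x y | y <- b] | x <- s] = map (map intr) M ->
  [seq inner x (lincomb d b) | x <- s] = map intr [seq int_dot d g | g <- M].
Proof.
elim: s M => [|x s IHs] [|g M]//= [xb /IHs ->]; congr (_ :: _).
rewrite innerC; apply: inner_lincomb; rewrite -xb.
by apply: eq_map => y; rewrite innerC.
Qed.

Lemma e6_basis_inner b c d : e6_basis b ->
  inner (lincomb c b) (lincomb d b) = (e6_form c d)%:~R.
Proof. by move=> /inner_lincombs => /(_ d)/inner_lincomb ->. Qed.

Lemma lincomb_closed (P : 'rV[R]_7 -> Prop) b c : P 0 ->
    (forall x y, P x -> P y -> P (x + y)) ->
    (forall (k : int) x, P x -> P (k%:~R *: x)) ->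
  {in b, forall x, P x} -> P (lincomb c b).
Proof.
move=> P0 PD PZ; rewrite /lincomb; elim: c b => [|k c IHc] [|x b]//= Pb.
apply: PD; first by apply/PZ/Pb; rewrite mem_head.
by apply: IHc => y yb; apply: Pb; rewrite inE yb orbT.
Qed.

Lemma lincomb_mulmx b c (Q : 'M[R]_7) :
  lincomb c b *m Q = lincomb c [seq x *m Q | x <- b].
Proof.
rewrite /lincomb; elim: c b => [|k c IHc] [|x b]//=; rewrite ?mul0mx//.
by rewrite mulmxDl -scalemxAl IHc.
Qed.

(** An integral combination of norm 2 missing from [t] could be adjoined to it, giving 73 integral
    roots. So [t] contains the 72 combinations, and it has no further elements by cardinality. *)
Lemma integral_rootsE e t b : inner e e != 0 -> integral_roots e t ->
    (72 <= size t)%N -> {subset b <= t} -> e6_basis b ->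
  t =i [seq lincomb c b | c <- e6_roots].
Proof.
move=> e0 roots_t t_ge sub_bt basis_b; have [uniq_t tP t_int] := roots_t.
have [size_t _] := integral_roots_max e0 roots_t t_ge.
have [size_l uniq_l formE form_inj] := svalP e6_form_roots.
rewrite -/e6_roots in size_l uniq_l formE form_inj.
have uniq_c : uniq [seq lincomb c b | c <- e6_roots].
  rewrite map_inj_in_uniq// => c d cr dr cd; apply: form_inj => //.
  apply: (@intr_inj R); rewrite -(e6_basis_inner _ _ basis_b) -cd.
  by rewrite e6_basis_inner// formE.
have sub_ct : {subset [seq lincomb c b | c <- e6_roots] <= t}.
  move=> _ /mapP[c cr ->]; set y := lincomb c b.
  have yy : inner y y = 2 by rewrite e6_basis_inner// formE.
  have ye : inner y e = 0.
    apply: (lincomb_closed (P := fun x => inner x e = 0)).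
    - exact: inner0l.
    - by move=> u v ue ve; rewrite innerDl ue ve addr0.
    - by move=> k u ue; rewrite innerZl ue mulr0.
    - by move=> x /sub_bt/tP[].
  have y_int x : x \in t -> inner y x \is a Num.int.
    move=> xt; apply: (lincomb_closed (P := fun y => inner y x \is a Num.int)).
    - by rewrite inner0l.
    - by move=> u v ux vx; rewrite innerDl rpredD.
    - by move=> k u ux; rewrite innerZl rpredM// intr_int.
    - by move=> u /sub_bt ut; apply: t_int.
  apply/negPn/negP => yt.
  have : integral_roots e (y :: t).
    split; first by rewrite /= yt.
      by move=> x; rewrite inE => /orP[/eqP->|/tP//].
    move=> u v; rewrite !inE => /orP[/eqP->|ut] /orP[/eqP->|vt].
    - by rewrite yy.
    - exact: y_int.
    - by rewrite innerC y_int.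
    - exact: t_int.
  move=> /(integral_roots_max e0)[]; first by rewrite /= size_t.
  by rewrite /= size_t.
have [|_ eq_mem] := uniq_min_size uniq_c sub_ct.
  by rewrite size_map size_l size_t.
by move=> x; rewrite eq_mem.
Qed.

Definition row_matrix (s : seq 'rV[R]_7) : 'M[R]_7 := \matrix_(i < 7) s`_i.

Lemma row_matrix_gram (s : seq 'rV[R]_7) i j :
  (row_matrix s *m (row_matrix s)^T) i j = inner s`_i s`_j.
Proof. by rewrite mxE; apply: eq_bigr => k _; rewrite !mxE. Qed.

Lemma e6_basis_perp e b i : {in b, forall x, inner x e = 0} -> inner b`_i e = 0.
Proof.
move=> be; have [ltib|leib] := ltnP i (size b); first exact/be/mem_nth.
(* Past the end of [b] the entry is the default 0, which is orthogonal to [e] too. *)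
by rewrite nth_default// inner0l.
Qed.

Lemma e6_basis_size b : e6_basis b -> size b = 6.
Proof. by move=> /(congr1 size); rewrite !size_map. Qed.

Lemma e6_basis_nth b i j : e6_basis b -> (i < 6)%N -> (j < 6)%N ->
  inner b`_i b`_j = (nth 0 (nth [::] e6_gram i) j)%:~R.
Proof.
move=> basis_b i6 j6; have size_b := e6_basis_size basis_b.
have := congr1 (fun M => nth 0 (nth [::] M i) j) basis_b.
rewrite (nth_map 0) ?size_b// (nth_map 0) ?size_b// => ->.
rewrite (nth_map [::])// (nth_map 0)//.
by case: i j i6 j6 => [|[|[|[|[|[|]]]]]] [|[|[|[|[|[|]]]]]].
Qed.

(** The Gram matrix of [e :: b] is the block sum of [inner e e] and [e6_gram], whose determinant is
    3. *)
Lemma e6_basis_unit e b : inner e e != 0 -> e6_basis b ->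
  {in b, forall x, inner x e = 0} -> row_matrix (e :: b) \in unitmx.
Proof.
move=> e0 basis_b be.
suff : row_matrix (e :: b) *m (row_matrix (e :: b))^T \in unitmx.
  by rewrite unitmx_mul => /andP[].
rewrite -row_free_unit; apply: inj_row_free => u uG0.
have eq0 (j : nat) : (j < 7)%N ->
    \sum_(i < 7) u 0 i * inner (e :: b)`_i (e :: b)`_j = 0.
  move=> j7; have : (u *m (row_matrix (e :: b) *m (row_matrix (e :: b))^T)) 0
    (Ordinal j7) = 0 by rewrite uG0 mxE.
  rewrite mxE; apply: etrans; apply: eq_bigr => i _.
  by rewrite row_matrix_gram.
pose f i : R := u 0 (inord i).
have {}eq0 (j : nat) : (j < 7)%N ->
    \sum_(i < 7) f i * inner (e :: b)`_i (e :: b)`_j = 0.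
  by move=> /eq0; apply: etrans; apply: eq_bigr => i _; rewrite /f inord_val.
have be' i : inner b`_i e = 0 by apply: e6_basis_perp.
have eb' i : inner e b`_i = 0 by rewrite innerC.
have f0 : f 0 = 0.
  have := eq0 0 isT; rewrite !big_ord_recl big_ord0 /= !be' !mulr0 !addr0.
  by move=> /eqP; rewrite mulf_eq0 (negbTE e0) orbF => /eqP.
have eqS j : (j < 6)%N -> \sum_(i < 6) f i.+1 * (nth 0 (nth [::] e6_gram i) j)%:~R = 0.
  move=> j6; have := eq0 j.+1 j6; rewrite big_ord_recl /= eb' mulr0 add0r.
  by apply: etrans; apply: eq_bigr => i _; rewrite /= e6_basis_nth// ltn_ord.
have E0 := eqS 0 isT; have E1 := eqS 1 isT; have E2 := eqS 2 isT.
have E3 := eqS 3 isT; have E4 := eqS 4 isT; have E5 := eqS 5 isT.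
move: E0 E1 E2 E3 E4 E5; rewrite !big_ord_recl !big_ord0 /=.
rewrite /bump /= => E0 E1 E2 E3 E4 E5.
have fE i : (i < 7)%N -> f i = 0.
  by case: i => [|[|[|[|[|[|[|]]]]]]]// _; lra.
by apply/rowP => i; rewrite mxE -(inord_val i); apply: fE.
Qed.

(** The two bases, each completed by [e] or [e'], have the same Gram matrix, and both sets of roots
    have the same coordinates in their bases. *)
Lemma integral_roots_isometry e t e' t' : inner e e != 0 ->
    inner e e = inner e' e' -> integral_roots e t -> integral_roots e' t' ->
    (72 <= size t)%N -> (72 <= size t')%N ->
  exists Q : 'M[R]_7, [/\ Q *m Q^T = 1%:M, e *m Q = e' &
    t' =i [seq x *m Q | x <- t]].
Proof.
move=> e0 ee' roots_t roots_t' t_ge t'_ge.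
have e'0 : inner e' e' != 0 by rewrite -ee'.
have [b bt basis_b] := integral_roots_e6_basis e0 roots_t t_ge.
have [b' bt' basis_b'] := integral_roots_e6_basis e'0 roots_t' t'_ge.
have perp : {in b, forall x, inner x e = 0}.
  by move=> x /bt xt; have [_ /(_ x xt)[]] := roots_t.
have perp' : {in b', forall x, inner x e' = 0}.
  by move=> x /bt' xt; have [_ /(_ x xt)[]] := roots_t'.
have size_b := e6_basis_size basis_b; have size_b' := e6_basis_size basis_b'.
have unitB := e6_basis_unit e0 basis_b perp.
have [|Q QQ BQ] := gram_isometry (B' := row_matrix (e' :: b')) _ unitB.
  apply/matrixP => i j; rewrite !row_matrix_gram.
  case: i j => [[|i] i7] [[|j] j7] //=.
  - by rewrite !(innerC _ (nth _ _ _)) !e6_basis_perp.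
  - by rewrite !e6_basis_perp.
  - by rewrite !e6_basis_nth.
have rowQ (i : nat) : (i < 7)%N -> (e :: b)`_i *m Q = (e' :: b')`_i.
  move=> i7; have := congr1 (row (Ordinal i7)) BQ.
  by rewrite row_mul !rowK.
exists Q; split => //; first exact: (rowQ 0).
have bQ : [seq x *m Q | x <- b] = b'.
  apply: (@eq_from_nth _ 0); rewrite size_map size_b ?size_b'// => i i6.
  by rewrite (nth_map 0) ?size_b//; apply: (rowQ i.+1).
move=> x; rewrite (integral_rootsE e'0 roots_t' t'_ge bt' basis_b').
have tE := integral_rootsE e0 roots_t t_ge bt basis_b.
apply/mapP/mapP => [[c cr ->]|[y]].
  exists (lincomb c b); last by rewrite lincomb_mulmx bQ.
  by rewrite tE; apply/mapP; exists c.
rewrite tE => /mapP[c cr ->] ->; exists c => //.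
by rewrite lincomb_mulmx bQ.
Qed.

End LinComb.

(** * From biangular lines to roots *)

Section Biangular.
Context {R : realType}.
Implicit Types (e v w x y : 'rV[R]_7) (s t : seq 'rV[R]_7).

Definition biangular s : Prop :=
  [/\ uniq s, {in s, forall x, inner x x = 5 / 2} &
      {in s &, forall x y, x != y -> inner x y = 1 / 2 \/ inner x y = - (1 / 2) \/
        inner x y = 3 / 2 \/ inner x y = - (3 / 2)}].

Lemma biangular_half_odd s : biangular s ->
  {in s &, forall x y, inner x y + 1 / 2 \is a Num.int}.
Proof.
case=> _ sn si x y xs ys; have [->|xy] := eqVneq x y.
  by rewrite sn// (_ : _ + _ = 3); [exact: (intr_int _ 3)|lra].
have [->|[->|[->|->]]] := si x y xs ys xy.
- by rewrite (_ : _ + _ = 1); [exact: (intr_int _ 1)|lra].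
- by rewrite (_ : _ + _ = 0); [exact: (intr_int _ 0)|lra].
- by rewrite (_ : _ + _ = 2); [exact: (intr_int _ 2)|lra].
- by rewrite (_ : _ + _ = -1); [exact: (intr_int _ (-1))|lra].
Qed.

Definition near v s := [seq w <- s | inner v w ^+ 2 == 9 / 4].

(** With [N = size s] and [c] the number sought, the row of [v] is [N / 4 + 2 c + 6]. Some row is at
    least [25 N / 28], and [N >= 72] then gives [c > 20]. *)
Lemma biangular_near s : biangular s -> (72 <= size s)%N ->
  exists2 v, v \in s & (21 <= size (near v s))%N.
Proof.
move=> [uniq_s sn si] s_ge.
have k0 : (0 : R) < 7%:R by lra.
have tr1 : \tr ((1%:M : 'M[R]_7) *m 1%:M) = 7%:R by rewrite mulmx1 mxtrace1.
have sP : {in s, forall x, x *m 1%:M = x} by move=> x _; rewrite mulmx1.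
have [+ _] := frame_bound k0 (trmx1 _ _) tr1 sP.
rewrite /= (eq_sumr_seq sn) sumr_seq_const => le_TQ.
have Nge : (72 : R) <= (size s)%:R by rewrite ler_nat.
have [v vs v_ge] : exists2 v, v \in s &
    25 / 28 * (size s)%:R <= \sum_(x <- s) inner v x ^+ 2.
  apply: exists_ge_average; first by case: (s) s_ge.
  by nra.
exists v => //; move: v_ge.
rewrite (@two_values_row_sum _ _ _ (fun w => inner v w ^+ 2 == 9 / 4) v
  (1 / 4) (9 / 4) (25 / 4))//; last 3 first.
- by rewrite sn//; lra.
- by rewrite sn//; apply/negP => /eqP; lra.
- move=> w ws wv; have [|->|[->|[->|->]]] := si v w vs ws; rewrite 1?eq_sym//.
  + by case: eqP; lra.
  + by case: eqP; lra.
  + by case: eqP; lra.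
  + by case: eqP; lra.
rewrite -size_filter -/(near v s) => le_v.
by rewrite -(ltr_nat R); lra.
Qed.

(** Chooses the sign for which an element of [near v s] has inner product 3/2 with [v]. *)
Definition towards v w := if 0 < inner v w then w else - w.

(** If two signed neighbours [w], [w'] of [v] have a negative inner product, then [w + w' - v] has
    norm [3 / 2 + 2 * inner w w']; being nonnegative, this is 1/2. Otherwise the differences [v - w]
    satisfy [star_bound], although there are at least 21 of them. *)
Lemma biangular_center s : biangular s -> (72 <= size s)%N ->
  exists2 e, inner e e = 1 / 2 & {in s, forall x, inner x e + 1 / 2 \is a Num.int}.
Proof.
move=> bi_s s_ge; have [uniq_s sn si] := bi_s.
have [v vs v_ge] := biangular_near bi_s s_ge.
have nearP w : w \in near v s -> [/\ w \in s, inner v (towards v w) = 3 / 2 &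
    inner (towards v w) (towards v w) = 5 / 2].
  rewrite mem_filter => /andP[vw ws]; split=> //.
    have [wv|wv] := eqVneq v w.
      by move: vw; rewrite wv sn// => /eqP; lra.
    rewrite /towards; have := si v w vs ws wv; move: vw => /eqP vw.
    by case: ifP => vw0 => -[vwE|[vwE|[vwE|vwE]]];
      move: vw vw0; rewrite ?innerNr vwE => ? /negP; try lra;
      rewrite ?oppr_gt0 ?ltr0n; lra.
  by rewrite /towards; case: ifP => _; rewrite ?innerNl ?innerNr ?opprK sn.
have towards_odd w x : w \in near v s -> x \in s ->
    inner x (towards v w) + 1 / 2 \is a Num.int.
  move=> /nearP[ws _ _] xs; have xw := biangular_half_odd bi_s xs ws.
  rewrite /towards; case: ifP => // _; rewrite innerNr.
  by rewrite (_ : _ + _ = 1 - (inner x w + 1 / 2)); [rewrite rpredB ?rpred1|lra].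
have towards_inner w w' : w \in s -> w' \in s -> w != w' ->
    inner (towards v w) (towards v w') = 1 / 2 \/
    inner (towards v w) (towards v w') = - (1 / 2) \/
    inner (towards v w) (towards v w') = 3 / 2 \/
    inner (towards v w) (towards v w') = - (3 / 2).
  move=> ws w's ww'; rewrite /towards; have := si w w' ws w's ww'.
  case: ifP => _; case: ifP => _; rewrite ?innerNl ?innerNr ?opprK//;
    by move=> [->|[->|[->|->]]]; rewrite ?opprK; tauto.
pose bad w w' := (w != w') && (inner (towards v w) (towards v w') < 0).
have [/hasP[w wt /hasP[w' w't /andP[ww' neg]]]|no_bad] :=
  boolP (has (fun w => has (bad w) (near v s)) (near v s)).
  have [ws vw nw] := nearP w wt; have [w's vw' nw'] := nearP w' w't.
  pose e := towards v w + towards v w' - v.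
  have ee : inner e e = 3 / 2 + 2 * inner (towards v w) (towards v w').
    rewrite /e !innerB nw nw' sn// vw vw' (innerC _ v) vw (innerC _ v) vw'.
    by rewrite (innerC (towards v w') (towards v w)); lra.
  have e_odd : {in s, forall x, inner x e + 1 / 2 \is a Num.int}.
    move=> x xs; rewrite /e !innerB.
    rewrite (_ : _ + _ = (inner x (towards v w) + 1 / 2)
      + (inner x (towards v w') + 1 / 2) - (inner x v + 1 / 2)); last by lra.
    apply: rpredB; last exact: biangular_half_odd bi_s _ _ xs vs.
    by apply: rpredD; apply: towards_odd.
  exists e => //; have := inner_ge0 e; rewrite ee; move: neg.
  by have [->|[->|[->|->]]] := towards_inner w w' ws w's ww'; lra.
exfalso; suff : (size (near v s) <= 20)%N by rewrite leqNgt v_ge.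
pose f w := v - towards v w.
have f01 : {in near v s &, forall x y, x != y ->
    inner (f x) (f y) = 0 \/ inner (f x) (f y) = 1}.
  move=> x y xt yt xy; have [xs vx nx] := nearP x xt; have [ys vy ny] := nearP y yt.
  have /hasPn/(_ x xt)/hasPn/(_ y yt) := no_bad.
  rewrite /bad xy /= -leNgt /f !innerB sn// vy (innerC _ v) vx.
  have [->|[->|[->|->]]] := towards_inner x y xs ys xy => ge0.
  - by left; lra.
  - by exfalso; lra.
  - by right; lra.
  - by exfalso; lra.
have f_norm : {in near v s, forall x, inner (f x) (f x) = 2 /\ inner (f x) v = 1}.
  move=> x /nearP[_ vx nx].
  by rewrite /f !innerB (innerC _ v) sn// vx nx; split; lra.
rewrite -(size_map f); apply: (@star_bound _ _ v).
- rewrite map_inj_in_uniq ?filter_uniq// => x y xt yt fxy.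
  apply/eqP/negPn/negP => xy; have [nx _] := f_norm x xt.
  by have := f01 x y xt yt xy; rewrite -fxy nx; lra.
- by rewrite sn.
- by move=> _ /mapP[x xt ->]; exact: f_norm.
move=> _ _ /mapP[x xt ->] /mapP[y yt ->] fxy; apply: f01 => //.
by apply: contraNneq fxy => ->.
Qed.

Definition flip e x : bool := inner x e < 0.

(** When [inner e e] is 1/2 and [inner x e] is ±1/2, this is the projection of the signed [x] onto
    the complement of [e]. *)
Definition root_part e x := (-1) ^+ flip e x *: x - e.

Lemma biangular_roots s : biangular s -> (72 <= size s)%N ->
  exists2 e, inner e e = 1 / 2 & integral_roots e [seq root_part e x | x <- s].
Proof.
move=> bi_s s_ge; have [uniq_s sn si] := bi_s.
have [e ee e_odd] := biangular_center bi_s s_ge; exists e => //.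
(* By Cauchy-Schwarz the square of [inner x e] is at most 5/4, and ±1/2 are the only half-odd
   numbers in that range. *)
have flipE : {in s, forall x, inner ((-1) ^+ flip e x *: x) e = 1 / 2}.
  move=> x xs; have := cauchy_schwarz x e; rewrite sn// ee => cs.
  have [|k kE kle] := int_range (m := 2) (e_odd x xs).
    by apply/andP; split; nra.
  have {kE} xeE : inner x e = k%:~R - 1 / 2 by rewrite -kE; lra.
  have : k = 2 \/ k = 1 \/ k = 0 \/ k = -1 \/ k = -2 by lia.
  rewrite /flip innerZl; move: cs; rewrite xeE => cs [kE|[kE|[kE|[kE|kE]]]];
    move: cs; rewrite kE => cs; try (exfalso; lra).
    by rewrite ltNge (_ : 0 <= _); lra.
  by rewrite (_ : _ < _); lra.
have rootE : {in s &, forall x y, inner (root_part e x) (root_part e y) =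
    inner ((-1) ^+ flip e x *: x) ((-1) ^+ flip e y *: y) - 1 / 2}.
  move=> x y xs ys; rewrite /root_part; have := flipE x xs; have := flipE y ys.
  set x' := _ *: x; set y' := _ *: y => y'e x'e.
  by rewrite !(innerDl, innerDr, innerNl, innerNr) (innerC e) x'e y'e ee; lra.
have norm : {in s, forall x, inner (root_part e x) (root_part e x) = 2}.
  by move=> x xs; rewrite rootE// innerZl innerZr signrMK sn//; lra.
split.
(* If the root parts of distinct [x] and [y] agreed, the signed vectors would have inner product
   5/2. *)
- rewrite map_inj_in_uniq// => x y xs ys fxy; apply/eqP/negPn/negP => xy.
  have := norm x xs; rewrite {2}fxy rootE// innerZl innerZr.
  have := si x y xs ys xy; case: flip; case: flip; rewrite ?expr0 ?expr1;
    by move=> [->|[->|[->|->]]]; lra.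
- move=> _ /mapP[x xs ->]; split; first exact: norm.
  by rewrite /root_part innerDl innerNl flipE// ee; lra.
move=> _ _ /mapP[x xs ->] /mapP[y ys ->]; rewrite rootE// innerZl innerZr.
have xy := biangular_half_odd bi_s xs ys.
case: flip; case: flip; rewrite ?expr0 ?expr1.
- by rewrite (_ : _ - _ = inner x y + 1 / 2 - 1); [rewrite rpredB ?rpred1|lra].
- by rewrite (_ : _ - _ = - (inner x y + 1 / 2)); [rewrite rpredN|lra].
- by rewrite (_ : _ - _ = - (inner x y + 1 / 2)); [rewrite rpredN|lra].
- by rewrite (_ : _ - _ = inner x y + 1 / 2 - 1); [rewrite rpredB ?rpred1|lra].
Qed.

End Biangular.

(** * The roots of E8 and E6 *)

Section E8Lattice.
Context {R : realType}.
Local Open Scope classical_set_scope.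
Local Open Scope ring_scope.

Lemma Zgenerated_zmod n (G : set 'rV[R]_n) : zmod_closed (mem (Zgenerated G)).
Proof.
split=> [|x y /set_mem xG /set_mem yG]; apply/mem_set => M CM.
  by have [[M0 _] _] := CM; apply: set_mem.
have [[_ MB] _] := CM.
by apply: set_mem; apply: MB; apply: mem_set; [exact: (xG M CM)|exact: (yG M CM)].
Qed.

Lemma Zgenerated0 n (G : set 'rV[R]_n) : Zgenerated G 0.
Proof. by have [/set_mem] := Zgenerated_zmod G. Qed.

Lemma ZgeneratedB n (G : set 'rV[R]_n) x y :
  Zgenerated G x -> Zgenerated G y -> Zgenerated G (x - y).
Proof.
have [_ GB] := Zgenerated_zmod G => xG yG.
by apply: set_mem; apply: GB; apply: mem_set.
Qed.

Lemma ZgeneratedN n (G : set 'rV[R]_n) x : Zgenerated G x -> Zgenerated G (- x).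
Proof. by move=> xG; rewrite -sub0r; apply: ZgeneratedB => //; exact: Zgenerated0. Qed.

Lemma ZgeneratedD n (G : set 'rV[R]_n) x y :
  Zgenerated G x -> Zgenerated G y -> Zgenerated G (x + y).
Proof.
by move=> xG yG; rewrite -[y]opprK; apply: ZgeneratedB => //; apply: ZgeneratedN.
Qed.

Lemma ZgeneratedZ n (G : set 'rV[R]_n) (k : int) x :
  Zgenerated G x -> Zgenerated G (k%:~R *: x).
Proof.
move=> xG.
have pos (m : nat) : Zgenerated G (m%:R *: x).
  elim: m => [|m IHm]; first by rewrite scale0r; exact: Zgenerated0.
  by rewrite -natr1 scalerDl scale1r; apply: ZgeneratedD.
case: k => m; first exact: pos.
by rewrite NegzE mulrNz scaleNr; apply: ZgeneratedN; apply: pos.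
Qed.

Lemma Zgenerated_sub n (G : set 'rV[R]_n) x : G x -> Zgenerated G x.
Proof. exact: sub_smallest. Qed.

Lemma Zgenerated_sum n (G : set 'rV[R]_n) m (F : 'I_m -> 'rV[R]_n) :
  (forall i, Zgenerated G (F i)) -> Zgenerated G (\sum_(i < m) F i).
Proof.
by move=> FG; elim/big_ind: _ => //; [exact: Zgenerated0|exact: ZgeneratedD].
Qed.

Definition half_vec (c : seq int) : 'rV[R]_8 := \row_i ((c`_i)%:~R / 2).

(** The doubled coordinates of the vectors of E8: all of one parity, with sum divisible by 4. *)
Definition e8_coords (c : seq int) : Prop :=
  [/\ size c = 8%N, forall i : 'I_8, (2 %| c`_i - c`_0)%Z &
      (4 %| \sum_(i < 8) c`_i)%Z].

Lemma half_vecB c d : size c = 8%N -> size d = 8%N ->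
  half_vec c - half_vec d = half_vec [seq p.1 - p.2 | p <- zip c d].
Proof.
move=> sc sd; apply/rowP => i; rewrite !mxE (nth_map (0, 0)) ?size_zip ?sc ?sd//.
by rewrite nth_zip ?sc ?sd// rmorphB mulrBl.
Qed.

Lemma e8_coords_zmod : zmod_closed (mem [set half_vec c | c in e8_coords]).
Proof.
split=> [|_ _ /set_mem[c [sc pc tc] <-] /set_mem[d [sd pd td] <-]]; apply/mem_set.
  exists (nseq 8 0); last by apply/rowP => i; rewrite !mxE nth_nseq if_same mul0r.
  split=> [|i|]; rewrite ?size_nseq ?nth_nseq ?if_same//.
  by rewrite big1// => i _; rewrite nth_nseq if_same.
rewrite half_vecB//; set b := map _ _; exists b => //.
have bE (i : nat) : (i < 8)%N -> b`_i = c`_i - d`_i.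
  by move=> i8; rewrite (nth_map (0, 0)) ?size_zip ?sc ?sd// nth_zip ?sc ?sd.
split=> [|i|]; first by rewrite size_map size_zip sc sd.
  rewrite !bE// (_ : _ - _ = (c`_i - c`_0) - (d`_i - d`_0)); last by lia.
  exact: rpredB.
rewrite (eq_bigr (fun i : 'I_8 => c`_i - d`_i)) => [|i _]; last by rewrite bE.
by rewrite big_split/= sumrN rpredB.
Qed.

Lemma e8_coord i k : e8 i 0 k = (k == i)%:R :> R.
Proof. by rewrite mxE eqxx. Qed.

Lemma E8_half_vec x : E8 x -> exists2 c, e8_coords c & half_vec c = x.
Proof.
have genE (i j : 'I_8) (k : int) : (2 %| 1 + k)%Z ->
    exists2 c, e8_coords c & half_vec c = e8 i + k%:~R *: e8 j.
  move=> k2; pose f (l : nat) : int := 2 * ((l == i)%:Z + k * (l == j)%:Z).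
  have fE (l : 'I_8) : (mkseq f 8)`_l = f l by rewrite nth_mkseq.
  exists (mkseq f 8); last first.
    apply/rowP => l; rewrite !mxE !fE /f intrM intrD intrM !eqxx/=.
    by rewrite -!val_eqE/= -!pmulrn; lra.
  split=> [|l|]; first exact: size_mkseq.
    by rewrite fE (fE ord0) /f -mulrBr dvdz_mulr.
  rewrite (eq_bigr (fun l : 'I_8 => 2 * ((l == i)%:Z + k * (l == j)%:Z))); last first.
    by move=> l _; rewrite fE.
  rewrite -mulr_sumr big_split/= -mulr_sumr.
  have one (m : 'I_8) : \sum_(l < 8) (l == m)%:Z = 1.
    by rewrite (bigD1 m)//= eqxx big1 ?addr0// => l /negbTE->.
  by rewrite !one mulr1 (_ : 4 = 2 * 2)// dvdz_mul.
have D8_sub : @D8 R `<=` [set half_vec c | c in e8_coords].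
  apply: smallest_sub; first exact: e8_coords_zmod.
  move=> _ [i [j [->|->]]].
    by have [//|c cP cE] := genE i j 1; exists c; rewrite ?cE ?scale1r.
  by have [//|c cP cE] := genE i j (-1); exists c; rewrite ?cE// mulrNz scaleN1r.
suff : @E8 R `<=` [set half_vec c | c in e8_coords] by exact.
apply: smallest_sub; first exact: e8_coords_zmod.
move=> y [/D8_sub//|->]; exists (nseq 8 1); last first.
  by apply/rowP => i; rewrite !mxE nth_nseq ltn_ord; lra.
split=> [|i|]; rewrite ?size_nseq// ?nth_nseq ?ltn_ord ?subrr//.
rewrite (eq_bigr (fun=> 1)) => [|i _]; last by rewrite nth_nseq ltn_ord.
by rewrite sumr_const card_ord.
Qed.

(** Move every coordinate to the first one by the differences [e8 i - e8 ord0]; what remains is an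
    even multiple of [e8 ord0], and [e8 ord0 + e8 ord0] is a generator. *)
Lemma even_sum_D8 (d : 'I_8 -> int) : (2 %| \sum_(i < 8) d i)%Z ->
  @D8 R (\sum_(i < 8) (d i)%:~R *: e8 i).
Proof.
move=> /dvdzP[k dk].
have -> : \sum_(i < 8) (d i)%:~R *: e8 i = \sum_(i < 8) (d i)%:~R *: (e8 i - e8 ord0)
    + k%:~R *: (e8 ord0 + e8 ord0) :> 'rV[R]_8.
  under [X in _ = X + _]eq_bigr do rewrite scalerBr.
  rewrite big_split/= sumrN -scaler_suml -rmorph_sum/= dk rmorphM/=.
  have -> : k%:~R * 2%:~R = k%:~R + k%:~R :> R by lra.
  by rewrite scalerDr -scalerDl addrNK.
apply: ZgeneratedD.
  apply: Zgenerated_sum => i; apply: ZgeneratedZ; apply: Zgenerated_sub.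
  by exists i, ord0; right.
by apply: ZgeneratedZ; apply: Zgenerated_sub; exists ord0, ord0; left.
Qed.

(** Write [c = 2 d + p] with [p] the common parity. Divisibility of [2 * sum d + 8 * p] by 4 makes
    the sum of [d] even. *)
Lemma half_vec_E8 c : e8_coords c -> E8 (half_vec c).
Proof.
move=> [sc pc tc]; pose p := (c`_0 %% 2)%Z; pose d (i : nat) := ((c`_i - p) %/ 2)%Z.
have cE (i : 'I_8) : c`_i = d i * 2 + p.
  rewrite /d divzK ?subrK// /p.
  rewrite (_ : _ - _ = (c`_i - c`_0) + (c`_0 - (c`_0 %% 2)%Z)); last by lia.
  by apply: rpredD => //; rewrite {1}(divz_eq c`_0 2) addrK dvdz_mull.
have even_d : (2 %| \sum_(i < 8) d i)%Z.
  have : (4 %| (\sum_(i < 8) d i) * 2 + 8 * p)%Z.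
    rewrite mulr_suml -(_ : \sum_(i < 8) p = 8 * p); last first.
      by rewrite sumr_const card_ord; lia.
    by rewrite -big_split/= -(eq_bigr _ (fun i _ => cE i)).
  lia.
have -> : half_vec c = \sum_(i < 8) (d i)%:~R *: e8 i + p%:~R *: (2^-1 *: const_mx 1).
  apply/rowP => k; rewrite !mxE summxE (bigD1 k)//= big1 => [|i ik].
    by rewrite !mxE eqxx/= eqxx cE intrD intrM /=; lra.
  by rewrite mxE e8_coord eq_sym (negbTE ik) mulr0.
apply: ZgeneratedD.
  by apply: Zgenerated_sub; left; exact: even_sum_D8.
by apply: ZgeneratedZ; apply: Zgenerated_sub; right.
Qed.

Lemma inner_half_vec c d :
  inner (half_vec c) (half_vec d) = (\sum_(i < 8) c`_i * d`_i)%:~R / 4.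
Proof.
rewrite rmorph_sum/= mulr_suml; apply: eq_bigr => i _.
by rewrite !mxE intrM; lra.
Qed.

Lemma E8_integral (x y : 'rV[R]_8) : E8 x -> E8 y -> inner x y \is a Num.int.
Proof.
move=> /E8_half_vec[c [_ pc tc] <-] /E8_half_vec[d [_ pd td] <-].
suff /dvdzP[k kE] : (4 %| \sum_(i < 8) c`_i * d`_i)%Z.
  rewrite inner_half_vec kE intrM (_ : _ / 4 = k%:~R) ?intr_int//.
  by rewrite -[4%:~R]/(4%:R) mulfK// pnatr_eq0.
(* Centring at the first coordinates makes each term divisible by 4: the differences are even, and
   both coordinate sums are multiples of 4. *)
have -> : \sum_(i < 8) c`_i * d`_i = \sum_(i < 8) (c`_i - c`_0) * (d`_i - d`_0)
    + c`_0 * (\sum_(i < 8) d`_i - d`_0 * 8) + d`_0 * \sum_(i < 8) c`_i.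
  rewrite mulrBr !mulr_sumr (_ : c`_0 * (d`_0 * 8) = \sum_(i < 8) c`_0 * d`_0).
    by rewrite -sumrB -!big_split; apply: eq_bigr => i _ /=; lia.
  by rewrite sumr_const card_ord; lia.
apply: rpredD; last by rewrite dvdz_mull.
apply: rpredD; last by rewrite dvdz_mull// rpredB// dvdz_mull.
apply: rpred_sum => i _; rewrite (_ : 4 = 2 * 2)//; apply: dvdz_mul => //.
Qed.

End E8Lattice.

(** * Enumeration of the 240 roots of E8 *)

Fixpoint square_sum_seqs (vals : seq int) (n m : nat) : seq (seq int) :=
  if n is n'.+1 then
    flatten [seq [seq k :: c | c <- square_sum_seqs vals n' (m - absz k ^ 2)]
            | k <- [seq k <- vals | absz k ^ 2 <= m]%N]
  else if m == 0 then [:: [::]] else [::].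

Lemma mem_square_sum_seqs vals n m c : (c \in square_sum_seqs vals n m) =
  [&& size c == n, all [in vals] c & sumn [seq absz k ^ 2 | k <- c] == m]%N.
Proof.
elim: n m c => [|n IHn] m c /=.
  by case: c => [|k c]; case: m => [|m] //=; rewrite ?inE ?in_nil ?andbF.
apply/flatten_mapP/idP => [[k]|].
  rewrite mem_filter => /andP[km kv] /mapP[d + ->].
  rewrite IHn => /and3P[/eqP sd vd /eqP md].
  by rewrite /= eqSS sd kv vd eqxx /= md subnKC.
case: c => [|k c]//= /and3P[/eqP[sc] /andP[kv cv] /eqP mE].
exists k; first by rewrite mem_filter kv andbT -mE leq_addr.
apply/mapP; exists c => //.
by rewrite IHn sc cv eqxx -mE addKn eqxx.
Qed.

(** Norm 2 means that the doubled coordinates have square sum 8: the even ones are 0 or ±2, the odd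
    ones ±1. The sum is a [foldr] so that it evaluates. *)
Definition e8_short_seqs : seq (seq int) :=
  [seq c <- square_sum_seqs [:: -2; 0; 2] 8 8 ++ square_sum_seqs [:: -1; 1] 8 8
  | (4 %| foldr +%R 0 c)%Z].

Definition second_moment (l : seq (seq int)) (i j : nat) : int :=
  foldr (fun c s => c`_i * c`_j + s) 0 l.

Lemma sum_nth_foldr n (c : seq int) : size c = n ->
  \sum_(i < n) c`_i = foldr +%R 0 c.
Proof.
move=> <-; rewrite -(big_mkord xpredT (fun i => c`_i)) -(big_nth 0 xpredT id).
by elim: c => [|k c IHc]; rewrite ?big_nil// big_cons IHc.
Qed.

Lemma sum_sqr_sumn n (c : seq int) : size c = n ->
  \sum_(i < n) c`_i * c`_i = sumn [seq absz k ^ 2 | k <- c]%N.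
Proof.
move=> <-; rewrite -(big_mkord xpredT (fun i => c`_i * c`_i)).
rewrite -(big_nth 0 xpredT (fun k => k * k)).
elim: c => [|k c IHc]; rewrite ?big_nil// big_cons IHc /= PoszD; congr (_ + _).
by rewrite -abszX gez0_abs ?sqr_ge0// expr2.
Qed.

Lemma e8_short_seqsP c : c \in e8_short_seqs <->
  e8_coords c /\ \sum_(i < 8) c`_i * c`_i = 8.
Proof.
rewrite mem_filter mem_cat !mem_square_sum_seqs; split.
  move=> /andP[c4 c_or].
  have sc : size c = 8%N by case/orP: c_or => /and3P[/eqP].
  split; last by rewrite (sum_sqr_sumn sc); case/orP: c_or => /and3P[_ _ /eqP ->].
  split=> [//|i|]; last by rewrite (sum_nth_foldr sc).
  have ci : c`_i \in c by rewrite mem_nth ?sc.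
  have c0 : c`_0 \in c by rewrite mem_nth ?sc.
  case/orP: c_or => /and3P[_ /allP cv _].
    move: (cv _ ci) (cv _ c0); rewrite !inE.
    by move=> /or3P[]/eqP-> /or3P[]/eqP->.
  by move: (cv _ ci) (cv _ c0); rewrite !inE => /orP[]/eqP-> /orP[]/eqP->.
move=> [[sc pc tc] norm_c]; apply/andP; split; first by rewrite -(sum_nth_foldr sc).
have sumn8 : sumn [seq absz k ^ 2 | k <- c]%N = 8%N.
  by apply/eqP; rewrite -eqz_nat -(sum_sqr_sumn sc) norm_c.
have small (i : 'I_8) : c`_i * c`_i <= 8.
  rewrite -norm_c (bigD1 i)//= lerDl sumr_ge0// => j _.
  by rewrite -expr2 sqr_ge0.
have in_c k : k \in c -> k * k <= 8 /\ (2 %| k - c`_0)%Z.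
  move=> /(nthP 0)[i i8 <-]; rewrite sc in i8.
  by have := small (Ordinal i8); have := pc (Ordinal i8).
rewrite sc sumn8 !eqxx !andbT /=; apply/orP.
have [c0|c0] := boolP (2 %| c`_0)%Z; [left|right]; apply/allP => k /in_c[kk kc].
  have : k = -2 \/ k = 0 \/ k = 2.
    have k2 : (2 %| k)%Z by lia.
    have : -2 <= k <= 2 by nia.
    lia.
  by case=> [->|[->|->]].
have : k = -1 \/ k = 1.
  have k2 : ~~ (2 %| k)%Z by lia.
  have : -2 <= k <= 2 by nia.
  lia.
by case=> [->|->].
Qed.

Lemma e8_short_seqs_size : size e8_short_seqs = 240%N.
Proof. by apply/eqP; vm_compute. Qed.

Lemma e8_short_seqs_uniq : uniq e8_short_seqs.
Proof. by vm_compute. Qed.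

(** The roots of E8 form a tight frame; halving the coordinates turns the constant 240 into 60. *)
Lemma e8_second_moment (i j : 'I_8) :
  \sum_(c <- e8_short_seqs) c`_i * c`_j = if i == j then 240 else 0.
Proof.
have -> : \sum_(c <- e8_short_seqs) c`_i * c`_j = second_moment e8_short_seqs i j.
  elim: e8_short_seqs => [|c l IHl]; first by rewrite big_nil.
  by rewrite big_cons IHl.
have mom : all (fun i => all (fun j =>
    second_moment e8_short_seqs i j == if i == j then 240 else 0) (iota 0 8)) (iota 0 8).
  by vm_compute.
have i8 : val i \in iota 0 8 by rewrite mem_iota ltn_ord.
have j8 : val j \in iota 0 8 by rewrite mem_iota ltn_ord.
exact: eqP (allP (allP mom _ i8) _ j8).
Qed.

(** * The 72 roots of E6 among those of E8 *)

Section E6Count.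
Context {R : realType}.
Implicit Types x y z : 'rV[R]_8.

Lemma half_vec_inj c d : size c = 8%N -> size d = 8%N ->
  half_vec c = half_vec d :> 'rV[R]_8 -> c = d.
Proof.
move=> sc sd cd; apply: (@eq_from_nth _ 0); rewrite sc ?sd// => i i8.
have /rowP/(_ (Ordinal i8)) := cd; rewrite !mxE => cdi.
by apply: (@intr_inj R); move: cdi => /=; lra.
Qed.

Lemma E8_roots_seq : exists l : seq 'rV[R]_8, [/\ uniq l, size l = 240%N,
  forall z, z \in l <-> roots_of E8 z & frame l = 60%:M].
Proof.
have := e8_short_seqs_uniq; have := e8_short_seqs_size.
have := e8_short_seqsP; have := e8_second_moment.
(* Forgetting the value of the list keeps the 240 sequences from being unfolded. *)
generalize e8_short_seqs => l l_mom lP l_size l_uniq.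
exists (map half_vec l); split.
- rewrite map_inj_in_uniq// => c d /lP[[sc _ _] _] /lP[[sd _ _] _].
  exact: half_vec_inj.
- by rewrite size_map.
- move=> z; split=> [/mapP[c /lP[cP norm_c] ->]|[/E8_half_vec[c cP <-] norm_z]].
    split; first exact: half_vec_E8.
    by rewrite /= /norm2 inner_half_vec norm_c; lra.
  apply/mapP; exists c => //; apply/lP; split=> //.
  apply: (@intr_inj R); move: norm_z.
  by rewrite /= /norm2 inner_half_vec => norm_z; lra.
apply/matrixP => i j; rewrite /frame summxE big_map mxE.
under eq_bigr => c _ do rewrite !mxE big_ord1 !mxE.
have mom : \sum_(c <- l) (c`_i)%:~R * (c`_j)%:~R = (if i == j then 240 else 0) :> R.
  transitivity ((\sum_(c <- l) c`_i * c`_j)%:~R : R); last first.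
    by rewrite l_mom; case: eqP.
  by rewrite rmorph_sum/=; apply: eq_bigr => c _; rewrite intrM.
rewrite (eq_bigr (fun c : seq int => 4^-1 * ((c`_i)%:~R * (c`_j)%:~R))).
  by rewrite -mulr_sumr mom; case: eqP => _ /=; lra.
by move=> c _; lra.
Qed.

Lemma root_inner2 n (x z : 'rV[R]_n) : inner x x = 2 -> inner z z = 2 ->
  inner z x = 2 -> z = x.
Proof. by move=> xx zz zx; apply: inner_inj; rewrite ?zz ?xx. Qed.

Lemma root_innerN2 n (x z : 'rV[R]_n) : inner x x = 2 -> inner z z = 2 ->
  inner z x = -2 -> z = - x.
Proof.
by move=> xx zz zx; apply: inner_inj; rewrite !innerB ?xx ?zz ?zx; lra.
Qed.

(** For [z] among the six roots ±x, ±y, ±(x + y) of the hexagon, the inner products with [x], [y],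
    [x + y] have squares 4, 1, 1 in some order; the final term 2 cancels [1 - 3]. *)
Lemma hexagon_vertex_indicator (a b : R) : a != 0 ->
    a ^+ 2 + b ^+ 2 + (a + b) ^+ 2 = 6 ->
  ((a == 0) && (b == 0))%:R = 1 - 2^-1 * a ^+ 2 - 2^-1 * b ^+ 2
    - 2^-1 * (a + b) ^+ 2 + 2 * true%:R.
Proof. by move=> /negbTE->; rewrite /=; lra. Qed.

(** Unless all three numbers vanish, exactly two of them are ±1. *)
Lemma hexagon_inside_indicator (a b c : R) :
    a = 1 \/ a = 0 \/ a = -1 -> b = 1 \/ b = 0 \/ b = -1 ->
    c = 1 \/ c = 0 \/ c = -1 -> c = a + b ->
  ((a == 0) && (b == 0))%:R = 1 - 2^-1 * a ^+ 2 - 2^-1 * b ^+ 2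
    - 2^-1 * c ^+ 2 + 2 * false%:R.
Proof.
by move=> [->|[->|->]] [->|[->|->]] [->|[->|->]];
  rewrite ?oppr_eq0 ?oner_eq0 ?eqxx /=; lra.
Qed.

(** Over the 240 roots [z] of E8, the squares of the inner products with a fixed root sum to 120.
    Summing the indicator of orthogonality to [x] and [y] gives [240 - 3 * 60 + 2 * 6 = 72]. *)
Lemma E6_roots_seq x y : roots_of E8 x -> roots_of E8 y -> inner x y = -1 ->
  exists t : seq 'rV[R]_8, [/\ uniq t, size t = 72%N &
    forall z, z \in t <-> roots_of (E6 x y) z].
Proof.
move=> x_root y_root xy; have [l [l_uniq l_size lP l_frame]] := E8_roots_seq.
have [xE8 xx] := x_root; have [yE8 yy] := y_root.
rewrite /= /norm2 in xx yy.
pose w := x + y.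
have ww : inner w w = 2 by rewrite /w !innerB (innerC y) xx yy xy; lra.
have wE8 : E8 w by apply: ZgeneratedD.
pose perp z := (inner z x == 0) && (inner z y == 0).
exists (filter perp l); split; first exact: filter_uniq.
  pose s := [:: x; - x; y; - y; w; - w].
  have sP z : z \in s -> z \in l.
    by rewrite !inE => /or4P[|||/or3P[]] /eqP->; apply/lP; split => //;
      rewrite /= ?/norm2 ?innerNl ?innerNr ?opprK//; apply: ZgeneratedN.
  have s_uniq : uniq s.
    have neq (u v : 'rV[R]_8) : inner u x <> inner v x -> u != v.
      by move=> uv; apply/eqP => uE; apply: uv; rewrite uE.
    have neq' (u v : 'rV[R]_8) : inner u y <> inner v y -> u != v.
      by move=> uv; apply/eqP => uE; apply: uv; rewrite uE.
    have wx : inner w x = 1 by rewrite /w innerDl (innerC y) xx xy; lra.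
    have wy : inner w y = 1 by rewrite /w innerDl yy xy; lra.
    rewrite /s /= !inE !negb_or !andbT.
    rewrite !(neq x) ?(innerNl, innerC y x, xx, xy, wx); try lra.
    rewrite !(neq (- x)) ?(innerNl, innerC y x, xx, xy, wx); try lra.
    rewrite (neq y (- y)) ?(innerNl, innerC y x, xx, xy, wx); try lra.
    rewrite (neq y w) ?(innerNl, innerC y x, xx, xy, wx); try lra.
    rewrite (neq' y (- w)) ?(innerNl, yy, wy); try lra.
    rewrite (neq' (- y) w) ?(innerNl, yy, wy); try lra.
    rewrite (neq (- y) (- w)) ?(innerNl, innerC y x, xx, xy, wx); try lra.
    by rewrite (neq w (- w)) ?(innerNl, innerC y x, xx, xy, wx); try lra.
  have count_s : count [in s] l = 6%N.
    rewrite -size_filter -[RHS]/(size s); apply/perm_size/uniq_perm => //.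
      exact: filter_uniq.
    by move=> z; rewrite mem_filter; apply/andP/idP => [[]//|zs]; rewrite sP.
  have sum2 u : inner u u = 2 -> \sum_(z <- l) inner z u ^+ 2 = 120.
    move=> uu; have := inner_frame l u u.
    rewrite l_frame mul_mx_scalar innerZl uu => sum_u.
    by transitivity (60 * 2 : R); [rewrite sum_u; apply: eq_bigr|lra].
  apply/eqP; rewrite size_filter -(eqr_nat R) -sumr_count; apply/eqP.
  (* (z, x), (z, y) and their sum (z, w) are in {-1, 0, 1}, unless z is in s. *)
  rewrite (eq_sumr_seq (G := fun z => 1 - 2^-1 * inner z x ^+ 2
    - 2^-1 * inner z y ^+ 2 - 2^-1 * inner z w ^+ 2 + 2 * (z \in s)%:R)).
    rewrite !big_split/= !sumrN sumr_seq_const l_size -!mulr_sumr !sum2//.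
    by rewrite sumr_count count_s; lra.
  move=> z zl; have /lP[zE8 zz] := zl; rewrite /= /norm2 in zz.
  have zw : inner z w = inner z x + inner z y by rewrite innerDr.
  have zx_int := E8_integral zE8 xE8; have zy_int := E8_integral zE8 yE8.
  have zw_int := E8_integral zE8 wE8.
  have [zs|zs] := boolP (z \in s).
    rewrite zw; apply: hexagon_vertex_indicator; move: zs; rewrite !inE;
      case/or4P => [|||/or3P[]] /eqP->; clear -xx yy xy;
      rewrite ?/w ?innerB ?(innerC y x) ?xx ?yy ?xy; lra.
  have not2 u : u \in s -> - u \in s -> inner u u = 2 -> inner z u \is a Num.int ->
      inner z u = 1 \/ inner z u = 0 \/ inner z u = -1.
    move=> us Nus uu /(root_inner_cases zz uu)[|[|[|[]]]]; try tauto.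
      by move=> /(root_inner2 uu zz) zu; rewrite zu us in zs.
    by move=> /(root_innerN2 uu zz) zu; rewrite zu Nus in zs.
  have zxE : inner z x = 1 \/ inner z x = 0 \/ inner z x = -1.
    by apply: not2 => //; rewrite !inE eqxx ?orbT.
  have zyE : inner z y = 1 \/ inner z y = 0 \/ inner z y = -1.
    by apply: not2 => //; rewrite !inE eqxx ?orbT.
  have zwE : inner z w = 1 \/ inner z w = 0 \/ inner z w = -1.
    by apply: not2 => //; rewrite !inE eqxx ?orbT.
  exact: hexagon_inside_indicator.
move=> z; rewrite mem_filter; split.
  move=> /andP[/andP[/eqP zx /eqP zy]] /lP[zE8 zz].
  by split => //; split => //; split.
move=> [[[zE8 zx] zy] zz]; apply/andP; split; last by apply/lP.
by apply/andP; split; apply/eqP.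
Qed.

End E6Count.

(** * Conclusion *)

Section Main.
Context {R : realType}.
Local Open Scope classical_set_scope.
Local Open Scope card_scope.
Local Open Scope ring_scope.

Lemma card_eq_seq (T : choiceType) (X : set T) n : X #= `I_n ->
  exists s : seq T, [/\ uniq s, size s = n & X = [set` s]].
Proof.
move=> Xn; have /finite_fsetP[F XF] : finite_set X by apply/finite_setP; exists n.
exists (enum_fset F); split; first exact: fset_uniq.
  by rewrite XF in Xn; exact/card_eq_fsetP.
by rewrite XF.
Qed.

(** Covers infinite sets as well: any set that is too large contains [n.+1] distinct points, which
    suffice for a contradiction. *)
Lemma card_le_or_seq (T : choiceType) (X : set T) n :
  X #<= `I_n \/ exists s : seq T, [/\ uniq s, size s = n.+1 & [set` s] `<=` X].
Proof.
have from_seq (s : seq T) : uniq s -> (n < size s)%N -> [set` s] `<=` X ->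
    exists s : seq T, [/\ uniq s, size s = n.+1 & [set` s] `<=` X].
  move=> s_uniq n_lt sX; exists (take n.+1 s); split.
  - exact: take_uniq.
  - by rewrite size_takel.
  - by move=> x /mem_take; apply: sX.
have [/finite_setP[m Xm]|/infinite_set_fset-/(_ n.+1)[F FX n_lt]] :=
  pselect (finite_set X).
  have [mn|nm] := leqP m n; first by left; rewrite (card_le_eql Xm) card_le_II.
  have [s [s_uniq s_size XE]] := card_eq_seq Xm.
  by right; apply: (from_seq s); rewrite ?s_size// XE.
right; apply: (from_seq (enum_fset F)) => //; exact: fset_uniq.
Qed.

Lemma scale_biangular (X : set 'rV[R]_7) (s : seq 'rV[R]_7) :
    X `<=` usphere 7 ->
    inner_values X `<=` [set 1 / 5; - (1 / 5); 3 / 5; - (3 / 5)] ->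
    uniq s -> [set` s] `<=` X ->
  biangular [seq Num.sqrt (5 / 2) *: x | x <- s].
Proof.
move=> X_sphere X_inner s_uniq sX.
have k2 : Num.sqrt (5 / 2) * Num.sqrt (5 / 2) = 5 / 2 :> R.
  by rewrite -expr2 sqr_sqrtr//; lra.
have innerk (x y : 'rV[R]_7) :
    inner (Num.sqrt (5 / 2) *: x) (Num.sqrt (5 / 2) *: y) = 5 / 2 * inner x y.
  by rewrite innerZl innerZr mulrA k2.
have k_neq0 : Num.sqrt (5 / 2) != 0 :> R by rewrite sqrtr_eq0 -ltNge; lra.
split.
- by rewrite map_inj_uniq//; exact: scalerI.
- move=> _ /mapP[x xs ->]; rewrite innerk (_ : inner x x = 1) ?mulr1//.
  exact: X_sphere (sX x xs).
move=> _ _ /mapP[x xs ->] /mapP[y ys ->] xy; rewrite innerk.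
have : inner_values X (inner x y).
  exists x, y; split; [exact: sX|exact: sX| |by []].
  by apply: contraNneq xy => ->.
by move=> /X_inner[[[]|]|] ->; lra.
Qed.

Lemma inner_row_mx m n (a c : 'rV[R]_m) (b d : 'rV[R]_n) :
  inner (row_mx a b) (row_mx c d) = inner a c + inner b d.
Proof. by rewrite !innerE tr_row_mx mul_row_col mxE. Qed.

Lemma X7_roots (x y : 'rV[R]_8) (phi : {linear 'rV[R]_8 -> 'rV[R]_6}) :
    roots_of E8 x -> roots_of E8 y -> inner x y = -1 ->
    isometry_from (linear_span (E6 x y)) phi ->
  exists e : 'rV[R]_7, exists t : seq 'rV[R]_7,
    [/\ inner e e = 1 / 2, integral_roots e t, size t = 72%N &
        X7 x y phi = [set Num.sqrt (2 / 5) *: (r + e) | r in [set` t]]].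
Proof.
move=> x_root y_root xy [phi_inner _].
have [t [t_uniq t_size tP]] := E6_roots_seq x_root y_root xy.
have span z : E6 x y z -> linear_span (E6 x y) z by exact: sub_smallest.
have phiP : {in t &, forall u v, inner (phi u) (phi v) = inner u v}.
  move=> u v /tP[uE6 _] /tP[vE6 _]; apply: phi_inner;
    by apply: mem_set; exact: span.
have sqrt_half : Num.sqrt (1 / 2) * Num.sqrt (1 / 2) = 1 / 2 :> R.
  by rewrite -expr2 sqr_sqrtr//; lra.
(* The height is chosen so that scaling by the root of 2/5 turns it into the last coordinate, the
   root of 1/5, of [X7]. *)
pose e : 'rV[R]_(6 + 1) := row_mx 0 (const_mx (Num.sqrt (1 / 2))).
pose f z : 'rV[R]_(6 + 1) := row_mx (phi z) 0.
have tt z : z \in t -> inner z z = 2 by move=> /tP[].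
have fP : {in t &, forall u v, inner (f u) (f v) = inner u v}.
  by move=> u v ut vt; rewrite inner_row_mx inner0l addr0 phiP.
have ee : inner e e = 1 / 2.
  by rewrite /e inner_row_mx inner0l add0r /inner big_ord1 !mxE.
have fe z : inner (f z) e = 0.
  by rewrite /f /e inner_row_mx inner0l innerC inner0l addr0.
exists e, (map f t); split=> //.
- split.
  + rewrite map_inj_in_uniq// => u v ut vt fuv; apply: inner_inj; rewrite ?tt//.
    by rewrite -fP// fuv fP// tt.
  + move=> _ /mapP[z zt ->]; split; [by rewrite fP// tt|exact: fe].
  + move=> _ _ /mapP[u ut ->] /mapP[v vt ->]; rewrite fP//.
    by move: ut vt => /tP[[[uE8 _] _] _] /tP[[[vE8 _] _] _]; exact: E8_integral.
- by rewrite size_map.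
have X7E z : row_mx (Num.sqrt (2 / 5) *: phi z) (const_mx (Num.sqrt (1 / 5))) =
    Num.sqrt (2 / 5) *: (f z + e).
  rewrite /f /e add_row_mx addr0 add0r scale_row_mx; congr row_mx.
  apply/rowP => i; rewrite !mxE -sqrtrM; last by lra.
  by congr Num.sqrt; lra.
apply/seteqP; split=> [_ [z zE6 <-]|_ [_ /mapP[z zt ->] <-]].
  exists (f z) => //; first by apply/mapP; exists z => //; apply/tP.
by exists z; [apply/tP|exact: X7E].
Qed.

End Main.

Local Open Scope classical_set_scope.
Local Open Scope card_scope.
Local Open Scope ring_scope.

Theorem theorem4p6 (R : realType) (X : set 'rV[R]_7)
    (X_sphere : X `<=` usphere 7)
    (X_inner : inner_values X `<=`
       [set 1 / 5; - (1 / 5); 3 / 5; - (3 / 5)]) :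
  X #<= `I_72 /\
  forall (x y : 'rV[R]_8) (phi : {linear 'rV[R]_8 -> 'rV[R]_6}),
    roots_of E8 x -> roots_of E8 y -> inner x y = -1 ->
    isometry_from (linear_span (E6 x y)) phi ->
    X #= `I_72 -> equivalent X (X7 x y phi).
Proof.
have e_neq0 (e : 'rV[R]_7) : inner e e = 1 / 2 -> inner e e != 0.
  by move=> ee; rewrite lt0r_neq0// ee; lra.
split.
  (* From 73 points of [X] would arise 73 integral roots orthogonal to a vector of norm 1/2. *)
  have [//|[s [s_uniq s_size sX]]] := card_le_or_seq X 72; exfalso.
  have [|e ee roots_s] := biangular_roots (scale_biangular X_sphere X_inner s_uniq sX).
    by rewrite size_map s_size.
  have [] := integral_roots_max (e_neq0 e ee) roots_s.
    by rewrite !size_map s_size.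
  by rewrite !size_map s_size.
move=> x y phi x_root y_root xy phi_iso X72.
have [s [s_uniq s_size XE]] := card_eq_seq X72.
have sX : [set` s] `<=` X by rewrite XE.
have [|e ee roots_s] := biangular_roots (scale_biangular X_sphere X_inner s_uniq sX).
  by rewrite size_map s_size.
have [e' [t [ee' roots_t t_size X7E]]] := X7_roots x_root y_root xy phi_iso.
have [|||Q [QQ eQ tE]] := integral_roots_isometry (e_neq0 e ee) _ roots_s roots_t.
- by rewrite ee ee'.
- by rewrite !size_map s_size.
- by rewrite t_size.
pose k : R := Num.sqrt (5 / 2).
have k_inv : Num.sqrt (2 / 5) * k = 1 :> R.
  rewrite /k -sqrtrM; last by lra.
  have -> : 2 / 5 * (5 / 2) = 1 :> R by lra.
  exact: sqrtr1.
(* The signed vector [k *: v] is its root part plus [e], and [Q] sends [e] to [e']; the outer factor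
   undoes the scaling by [k]. *)
have flipE v : (-1) ^+ flip e (k *: v) *: (v *m Q) =
    Num.sqrt (2 / 5) *: (root_part e (k *: v) *m Q + e').
  rewrite /root_part mulmxBl eQ subrK -scalemxAl -scalemxAl !scalerA.
  by rewrite mulrCA k_inv mulr1.
exists Q, (fun v => flip e (k *: v)); split=> //.
rewrite X7E XE; apply/seteqP; split=> [_ [r /= rt <-]|_ [v /= vs <-]].
  move: rt; rewrite tE => /mapP[_ /mapP[_ /mapP[v vs ->] ->] ->].
  by exists v => //; exact: flipE.
exists (root_part e (k *: v) *m Q); last by rewrite flipE.
by rewrite /= tE; apply/map_f/map_f/map_f.
Qed.
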